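(* There exists an absolute constant $c>0$ such that the following holds for all integers $h,k\ge 2$ and $r\ge 3$. Every $n$-vertex $r$-uniform hypergraph $\mathcal{H}$ with at least $c\,k^{r-1}n^{1+1/h}$ edges contains Berge cycles of $k$ consecutive lengths, the shortest of which has length at most $2h$.
   Context: All hypergraphs are finite, simple (no repeated edges) and have a non-empty vertex set (so $n\ge 1$). An $r$-uniform hypergraph is one all of whose edges have exactly $r$ vertices. A Berge cycle of length $\ell$ ($\ell\ge 3$) is a hypergraph consisting of $\ell$ distinct edges $e_1,\dots,e_\ell$ for which there exist $\ell$ distinct vertices $v_1,\dots,v_\ell$ with $v_i,v_{i+1}\in e_i$ for $1\le i\le \ell-1$ and $v_1,v_\ell\in e_\ell$. The conclusion means: there is an integer $a\le 2h$ such that, for every $\ell\in\{a,a+1,\dots,a+k-1\}$, $\mathcal{H}$ contains a Berge cycle of length $\ell$ as a subhypergraph. *)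

(* Defs.v *)
From mathcomp Require Import all_boot.

Set Implicit Arguments.
Unset Strict Implicit.
Unset Printing Implicit Defensive.

(* A finite simple hypergraph with vertex set T is given by its edge set,
   E : {set {set T}}. *)

Definition uniform (T : finType) (r : nat) (E : {set {set T}}) : Prop :=
  forall e, e \in E -> #|e| = r.

(* ordS is the cyclic successor on 'I_l, so the last edge is required to
   contain the last and the first of the vertices v. *)
Definition berge_cycle (T : finType) (l : nat) (C : {set {set T}}) : Prop :=
  3 <= l /\
  exists (e : 'I_l -> {set T}) (v : 'I_l -> T),
    [/\ injective e, injective v, C = [set e i | i : 'I_l]
      & forall i : 'I_l, v i \in e i /\ v (ordS i) \in e i].

Definition contains_berge_cycle (T : finType) (E : {set {set T}}) (l : nat)
  : Prop :=
  exists2 C : {set {set T}}, C \subset E & berge_cycle l C.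

(* Main.v *)
Require Import Defs.
From mathcomp Require Import all_boot all_order all_algebra.
From mathcomp Require Import zify ring lra boolp reals exp.

Set Implicit Arguments.
Unset Strict Implicit.
Unset Printing Implicit Defensive.

(** Write n for the number of vertices.

    From uniformity r to 3. Call an (r-1)-set light if at most k edges contain
    it. Delete, as long as possible, all edges through a light (r-1)-set and
    charge them to it. If everything gets deleted, the light sets form an
    (r-1)-uniform hypergraph with at least |E|/k edges whose Berge cycles lift
    to E, since each light set can be sent to a private edge containing it. This
    loses exactly the factor k that the bound allows per unit of uniformity, so
    no constant depending on r appears. Otherwise a nonempty hypergraph is left
    in which every (r-1)-set is in no edge or in more than k edges. The
    link graph of an (r-2)-set S then has minimum degree above k; a path in
    it, closed up through one or two vertices of S, gives Berge cycles of all
    lengths 3, ..., k+2 ([rich_cycles], [reduce_to_three]).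

    Uniformity 3. Now |E| is at least of order k^2 n q with q of order n^(1/h).
    Colour the vertices with three colours so that a constant fraction of the
    edges is rainbow, pass to a subhypergraph of large minimum degree, and look
    at the distance spheres around a root. If the edges of minimum level i were
    few for all i < h, the spheres would grow by a factor above q, which is
    impossible over h levels ([heavy_layer]). So for some i < h there are order
    k^2 |U| edges on the vertex set U of levels i and i+1 which have their
    vertex x of one fixed colour on level i; let y and z be the vertices of the
    other two colours.

    Any set X of at least two vertices on level i can be split into two parts
    such that a vertex of one part is joined to one of the other, below level i,
    by a Berge path whose length d <= 2i depends on X only
    ([sphere_splits]). So it suffices to find, inside the edges of the layer,
    Berge paths of each length 2, ..., k+1 from one part to the other. The
    resulting cycles have lengths d+2, ..., d+k+1, and d+2 <= 2h.

    The paths come from a graph whose edges are represented by different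
    triples, and are two-coloured by the part of X containing their vertex x.
    A connected dense such graph has, in one of the two colours, a subgraph of
    large minimum degree, and connectivity provides an edge of the other
    colour from which a long path of the first colour starts
    ([bichromatic_walk]). Two graphs are used, according to whether most pairs
    (y, z) lie in at most two triples or in at least three.

    - At most two: the graph of the pairs (y, z) is dense. A path in it can be
      left at any step towards the vertex x of the triple in use, so every
      length occurs ([light_pairs_connections]).
    - At least three: unless the link graph of some x is dense, which again gives
      the lengths 3, ..., k+2, the graph of the pairs (x, y) or that of the pairs
      (x, z) is dense. Say it is the first. A path in it passes through X at every
      second step, so it yields the even lengths; inserting z between the
      first y and the next x, through a third triple on (y, z), yields the odd
      ones ([heavy_pairs_connections]). *)

(** * Berge walks and cycles *)

Section EPath.
Variable T : finType.
Implicit Types (E : {set {set T}}) (st : {set T} -> T -> T -> bool)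
  (x : T) (p : seq ({set T} * T)).

(** A Berge walk from [x] is the list of the pairs (edge used, vertex reached);
    [st e u v] tells whether [e] may be used to go from [u] to [v]. *)
Fixpoint epath st x p : bool :=
  if p is (e, y) :: p' then st e x y && epath st y p' else true.

Definition bstep (e : {set T}) (x y : T) := (x \in e) && (y \in e).

Lemma epath_cat st x p q :
  epath st x (p ++ q) = epath st x p && epath st (last x (unzip2 p)) q.
Proof. by elim: p x => [|[e y] p IH] x //=; rewrite IH andbA. Qed.

Lemma sub_epath st1 st2 x p :
    (forall e y z, e \in unzip1 p -> st1 e y z -> st2 e y z) ->
  epath st1 x p -> epath st2 x p.
Proof.
elim: p x => [|[e y] p IH] x //= sub /andP[h1 h2].
rewrite sub ?mem_head //= IH // => f u v fp; apply: sub.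
by rewrite inE fp orbT.
Qed.

Lemma epath_nth st x p i : epath st x p -> i < size p ->
  st (nth set0 (unzip1 p) i) (nth x (x :: unzip2 p) i) (nth x (unzip2 p) i).
Proof.
elim: p x i => [|[e y] p IH] x [|i] //= /andP[h1 h2] ip //.
rewrite !(set_nth_default y x) ?size_map //; first exact: IH.
by rewrite /= size_map ltnW.
Qed.

(** Edge number i of the closed walk joins vertices i and i+1 of [x :: unzip2 p],
    whose last entry is [x] again, as the cyclic successor in [berge_cycle]
    demands. *)
Lemma berge_of_closed_epath E x p : 3 <= size p -> epath bstep x p ->
    last x (unzip2 p) = x -> uniq (unzip1 p) -> uniq (unzip2 p) ->
  {subset unzip1 p <= E} -> contains_berge_cycle E (size p).
Proof.
move=> p3 pp lx u1 u2 sE; set l := size p in p3 *.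
pose e (i : 'I_l) := nth set0 (unzip1 p) i.
pose v (i : 'I_l) := nth x (x :: unzip2 p) i.
exists [set e i | i : 'I_l].
  apply/subsetP => _ /imsetP[i _ ->]; apply: sE; apply: mem_nth.
  by rewrite size_map.
have [s' Es] : exists s', unzip2 p = rcons s' x.
  move: lx p3; rewrite /l; case/lastP: (p) => [|p' [f y]] //=.
  by rewrite /unzip2 map_rcons last_rcons /= => -> _; exists (map snd p').
have ss : size s' = l.-1.
  by rewrite /l -(size_map snd p) -/(unzip2 p) Es size_rcons.
split=> //; exists e, v; split=> //.
- move=> i j /eqP; rewrite /e nth_uniq ?size_map // => /eqP h; exact: val_inj.
- have u3 : uniq (x :: s') by move: u2; rewrite Es rcons_uniq.
  have vE (i : 'I_l) : v i = nth x (x :: s') i.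
    rewrite /v Es -rcons_cons nth_rcons /= ss prednK; last by lia.
    by rewrite ltn_ord.
  move=> i j; rewrite !vE => /eqP; rewrite nth_uniq //=.
  + by move/eqP/val_inj.
  + by rewrite ss; have := ltn_ord i; lia.
  + by rewrite ss; have := ltn_ord j; lia.
- move=> i; have /andP[h1 h2] := epath_nth pp (ltn_ord i).
  split=> //; suff -> : v (ordS i) = nth x (unzip2 p) i by [].
  rewrite /v /=; have := ltn_ord i; rewrite leq_eqVlt => /orP[/eqP il|il].
    rewrite il modnn /= Es nth_rcons ss.
    have -> : nat_of_ord i = l.-1 by lia.
    by rewrite ltnn eqxx.
  by rewrite modn_small.
Qed.

End EPath.

(** * Dense sets, and walks in two-coloured graphs *)

Section DenseCore.
Variables (I T : finType) (s : I -> {set T}).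
Implicit Types (G : {set I}) (V W : {set T}) (D : nat).

Definition inside G V := [set e in G | s e \subset V].

(** A set that is minimal among the nonempty sets spanning at least [D] edges
    per vertex. Minimality gives large degrees and connectivity at once, the two
    properties for which such sets are used. *)
Definition dense_critical D G V : Prop :=
  [/\ V != set0, D * #|V| <= #|inside G V|
    & forall W, W \proper V -> W != set0 -> #|inside G W| < D * #|W|].

Lemma dense_critical_exists D G U :
    U != set0 -> D * #|U| <= #|inside G U| ->
  exists2 V : {set T}, V \subset U & dense_critical D G V.
Proof.
move=> U0 dU.
pose P V := [&& V != set0, V \subset U & D * #|V| <= #|inside G V|].
have PU : P U by rewrite /P U0 subxx.
case: (arg_minnP (fun V : {set T} => #|V|) PU) => V /and3P[V0 VU dV] minV.
exists V => //; split=> // W WV W0; rewrite ltnNge; apply/negP => dW.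
have /minV : P W by rewrite /P W0 dW (subset_trans (proper_sub WV) VU).
by rewrite leqNgt proper_card.
Qed.

(** Otherwise removing [v] would leave a smaller set which is still dense. *)
Lemma critical_degree D G V v :
    dense_critical D G V -> (forall e, e \in G -> s e != set0) -> v \in V ->
  D <= #|[set e in inside G V | v \in s e]|.
Proof.
move=> [V0 dV cV] s0 vV.
have split_v : #|inside G V| <=
    #|[set e in inside G V | v \in s e]| + #|inside G (V :\ v)|.
  rewrite -cardsUI; apply: leq_trans (leq_addr _ _); apply: subset_leq_card.
  apply/subsetP => e; rewrite !inE => /andP[eG eV]; rewrite eG eV /=.
  by case: (boolP (v \in s e)) => //= vNe; rewrite subsetD1 eV.
have VE : #|V| = #|V :\ v|.+1 by rewrite (cardsD1 v V) vV.
case: (eqVneq (V :\ v) set0) => [V1|V1].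
  have : #|inside G (V :\ v)| = 0.
    apply/eqP; rewrite cards_eq0; apply/eqP/setP => e; rewrite !inE V1 subset0.
    by apply/negP => /andP[/s0/negP].
  by move: dV split_v; rewrite VE V1 cards0 muln1; lia.
have : #|inside G (V :\ v)| < D * #|V :\ v|.
  by apply: cV => //; apply: properD1.
by move: dV; rewrite VE mulnS; lia.
Qed.

(** If no edge crossed from [W] to its complement, one of the two sides would
    still be dense. *)
Lemma critical_connected D G V W :
    dense_critical D G V -> W \subset V -> W != set0 ->
    (forall e, e \in inside G V -> s e \subset W \/ s e \subset V :\: W) ->
  W = V.
Proof.
move=> [V0 dV cV] WV W0 split_W.
apply/eqP; rewrite eqEsubset WV /=; apply/negPn/negP => VW.
have Wp : W \proper V by rewrite properE WV.
have W'0 : V :\: W != set0 by rewrite -subset0 subDset setU0.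
have W'p : V :\: W \proper V.
  rewrite properE subsetDl; case/set0Pn: W0 => w wW.
  apply/subsetPn; exists w; first exact: (subsetP WV).
  by rewrite inE wW.
have := cV _ Wp W0; have := cV _ W'p W'0.
have : #|inside G V| <= #|inside G W| + #|inside G (V :\: W)|.
  rewrite -cardsUI; apply: leq_trans (leq_addr _ _); apply: subset_leq_card.
  apply/subsetP => e eV; rewrite !inE.
  by have := eV; rewrite inE => /andP[-> _]; case: (split_W e eV) => ->; rewrite ?orbT.
have := cardsID W V; rewrite (setIidPr WV); nia.
Qed.

End DenseCore.

(** Choosing one index per value of [g] turns a family of triples into a graph
    whose edges are carried by different triples. *)
Lemma representatives (I J : finType) (g : I -> J) (M : {set I}) :
  exists2 G : {set I}, G \subset M & {in G &, injective g} /\ g @: G = g @: M.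
Proof.
pose r j := [pick e in M | g e == j].
exists [set e in M | r (g e) == Some e].
  by apply/subsetP => e; rewrite inE => /andP[].
split=> [e f|].
  rewrite !inE => /andP[_ /eqP re] /andP[_ /eqP rf] gef.
  by move: re; rewrite gef rf => -[].
apply/setP => j; apply/imsetP/imsetP => -[e eM ->].
  by exists e => //; move: eM; rewrite inE => /andP[].
case E : (r (g e)) => [f|]; last first.
  by move: E; rewrite /r; case: pickP => // /(_ e); rewrite eM eqxx.
have [fM fE] : f \in M /\ g f = g e.
  by move: E; rewrite /r; case: pickP => // f' /andP[? /eqP ?] [<-].
by exists f; rewrite // inE fM fE E eqxx.
Qed.

Section PairWalks.
Variables (T : finType) (s : {set T} -> {set T}) (G : {set {set T}}).
Hypothesis s_inj : {in G &, injective s}.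
Hypothesis s_pair : forall e, e \in G -> #|s e| = 2.
Implicit Types (u v w : T) (p : seq ({set T} * T)) (Q V W Z : {set T}).

(** Each [e] is seen as an edge, with ends [s e], of an ordinary graph; for
    injective [s] it is a simple graph whose edges carry different hyperedges. *)
Definition pstep (e : {set T}) u v := s e == [set u; v].

Lemma pair_other e v : e \in G -> v \in s e ->
  exists2 u, u != v & s e = [set v; u].
Proof.
move=> eG; have /eqP/cards2P[x [y [xy ->]]] := s_pair eG.
rewrite !inE => /orP[] /eqP->; first by exists y; rewrite // eq_sym.
by exists x; rewrite // setUC.
Qed.

Lemma epath_pairs_sub e v p : epath pstep v p -> e \in unzip1 p ->
  s e \subset v :: unzip2 p.
Proof.
elim: p v => [|[f u] p IH] v //= /andP[/eqP sf pp].
rewrite inE => /orP[/eqP->|ep].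
  by rewrite sf; apply/subsetP => x; rewrite !inE => /orP[]->; rewrite ?orbT.
apply: subset_trans (IH _ pp ep) _.
by apply/subsetP => x xp; rewrite inE xp orbT.
Qed.

(** The first edge contains the starting vertex, to which the path never
    returns, so it is not used again. *)
Lemma epath_uniq_edges v p : epath pstep v p -> uniq (v :: unzip2 p) ->
  uniq (unzip1 p).
Proof.
elim: p v => [|[f u] p IH] v //= /andP[sf pp] /andP[vN up].
rewrite (IH u) // andbT; apply/negP => fp.
have := subsetP (epath_pairs_sub pp fp) v.
rewrite (eqP sf) !inE eqxx => /(_ isT) h.
by move: vN; rewrite inE h.
Qed.

Lemma epath_suffix st v p w : epath st v p -> w \in v :: unzip2 p ->
  exists p1 p2, p = p1 ++ p2 /\ last v (unzip2 p1) = w.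
Proof.
elim: p v => [|[f u] p IH] v /=.
  by move=> _; rewrite inE => /eqP->; exists [::], [::].
move=> /andP[_ pp]; rewrite inE => /orP[/eqP->|wp].
  by exists [::], ((f, u) :: p).
by have [p1 [p2 [-> <-]]] := IH _ pp wp; exists ((f, u) :: p1), p2.
Qed.

(** The forbidden set [Z] grows by one vertex per step, so there is always a
    neighbour outside of it as long as its size is below the degree. *)
Lemma greedy_walk K Q m Z v :
    (forall u, u \in Q -> K <= #|[set e in inside s G Q | u \in s e]|) ->
    v \in Q -> #|Z| + m <= K ->
  exists p, [/\ size p = m, epath pstep v p, uniq (v :: unzip2 p),
    {subset unzip1 p <= G} & forall u, u \in unzip2 p -> u \in Q :\: Z].
Proof.
move=> deg; elim: m Z v => [|m IH] Z v vQ Zm; first by exists [::].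
have [e eQ [u [uv uZ se]]] : exists2 e, e \in inside s G Q &
    exists u, [/\ u != v, u \notin Z & s e = [set v; u]].
  apply: contrapT => noe.
  have : #|s @: [set e in inside s G Q | v \in s e]| <=
      #|[set [set v; z] | z in Z]|.
    apply: subset_leq_card; apply/subsetP => _ /imsetP[e + ->].
    rewrite inE => /andP[eQ ve].
    have eG : e \in G by move: eQ; rewrite inE => /andP[].
    have [u uv se] := pair_other eG ve.
    case: (boolP (u \in Z)) => uZ; first by apply/imsetP; exists u.
    by case: noe; exists e => //; exists u.
  rewrite card_in_imset; last first.
    by move=> x y; rewrite !inE => /andP[/andP[? _] _] /andP[/andP[? _] _];
       exact: s_inj.
  by move/leq_trans/(_ (leq_imset_card _ _)); have := deg v vQ; lia.
have [eG eQ'] : e \in G /\ s e \subset Q.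
  by move: eQ; rewrite inE => /andP[].
have uQ : u \in Q by apply: (subsetP eQ'); rewrite se !inE eqxx orbT.
have [||p [sp pp up pG pQ]] := IH (v |: Z) u => //.
  by have := cardsU1 v Z; case: (v \notin Z) => /=; lia.
exists ((e, u) :: p); split=> /=.
- by rewrite sp.
- by rewrite /pstep se eqxx.
- rewrite inE eq_sym (negPf uv) /=; move: up => /= ->; rewrite andbT.
  by apply/negP => /pQ; rewrite !inE eqxx.
- by move=> f; rewrite inE => /orP[/eqP->|/pG].
- move=> w; rewrite inE => /orP[/eqP->|/pQ]; first by rewrite inE uZ.
  by rewrite !inE negb_or => /andP[/andP[_ ->] ->].
Qed.

End PairWalks.

Section BichromaticWalk.
Variables (T : finType) (s : {set T} -> {set T}) (G : {set {set T}}).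
Hypothesis s_inj : {in G &, injective s}.
Hypothesis s_pair : forall e, e \in G -> #|s e| = 2.
Implicit Types (u v w : T) (p : seq ({set T} * T)) (Q V W Z : {set T}).
Local Notation pstep := (pstep s).

(** One colour class is dense, hence has a part [Q] of minimum degree [K]. Let
    [W] be the set of vertices joined to [Q] within this colour. Some edge
    of the other colour must meet [W], for otherwise no edge leaves [W], so that
    [W] is everything by connectivity. From such an edge one walks to [Q] and
    then greedily inside [Q]. *)
Lemma bichromatic_walk (P : pred {set T}) K V :
    0 < K -> V != set0 -> 2 * K * #|V| <= #|G| ->
    (forall e, e \in G -> s e \subset V) ->
    (forall W, W \subset V -> W != set0 ->
      (forall e, e \in G -> s e \subset W \/ s e \subset V :\: W) -> W = V) ->
    (exists2 e, e \in G & P e) -> (exists2 e, e \in G & ~~ P e) ->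
  exists e1 v1 p, [/\ e1 \in G, v1 \in s e1 & [/\ size p = K,
    epath pstep v1 p, uniq (v1 :: unzip2 p)
    & forall e, e \in unzip1 p -> e \in G /\ P e = ~~ P e1]].
Proof.
move=> K0 V0 dG GV conn [eP ePG hP] [eN eNG hN].
have [b db] : exists b, K * #|V| <= #|[set e in G | P e == b]|.
  have : #|G| <= #|[set e in G | P e == true]| + #|[set e in G | P e == false]|.
    rewrite -cardsUI; apply: leq_trans (leq_addr _ _); apply: subset_leq_card.
    by apply/subsetP => e eG; rewrite !inE eG; case: (P e).
  case: (leqP (K * #|V|) #|[set e in G | P e == true]|) => [h _|h h'].
    by exists true.
  by exists false; nia.
set Gb := [set e in G | P e == b] in db.
have GbG : {subset Gb <= G} by move=> e; rewrite inE => /andP[].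
have [||Q QV critQ] := @dense_critical_exists _ _ s K Gb V => //.
  apply: leq_trans db _; apply: subset_leq_card; apply/subsetP => e eb.
  by rewrite inE eb GV ?GbG.
have degQ u : u \in Q -> K <= #|[set e in inside s Gb Q | u \in s e]|.
  apply: critical_degree => // e /GbG/s_pair e2.
  by rewrite -cards_eq0 e2.
(* The path stops on entering [Q], so that its last vertex is the only one in [Q]
   and it can be prolonged inside [Q]. *)
pose good v := exists p, [/\ epath pstep v p, uniq (v :: unzip2 p),
  {subset unzip1 p <= Gb}, last v (unzip2 p) \in Q
  & forall u, u \in belast v (unzip2 p) -> u \notin Q].
pose W := [set v in V | `[< good v >]].
have QW : Q \subset W.
  apply/subsetP => v vQ; rewrite inE (subsetP QV) //=.
  by apply/asboolP; exists [::].
have closedW e u : e \in Gb -> u \in s e -> u \in W -> s e \subset W.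
  move=> eb ue uW; have [w wu se] := pair_other s_pair (GbG _ eb) ue.
  apply/subsetP => z; rewrite se !inE => /orP[] /eqP-> {z}.
    by move: uW; rewrite inE.
  have wV : w \in V.
    by apply: (subsetP (GV _ (GbG _ eb))); rewrite se !inE eqxx orbT.
  rewrite wV /=; case: (boolP (w \in Q)) => wQ.
    by have := subsetP QW w wQ; rewrite inE => /andP[].
  move: uW; rewrite inE => /andP[_ /asboolP[p [pp up pG pl pb]]].
  apply/asboolP; case: (boolP (w \in u :: unzip2 p)) => wp.
    have [p1 [p2 [pE lw]]] := epath_suffix pp wp.
    exists p2; move: pp up pl pb pG.
    rewrite pE epath_cat lw /unzip1 /unzip2 !map_cat last_cat lw.
    move=> /andP[_ ->] up -> pb pG; split=> //.
    - by move: up; rewrite -cat_cons lastI lw cat_rcons cat_uniq => /and3P[].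
    - by move=> f fp; apply: pG; rewrite mem_cat fp orbT.
    - move=> x xp; apply: pb; rewrite belast_cat mem_cat.
      by rewrite -lw in xp; rewrite xp orbT.
  exists ((e, u) :: p); split=> //=.
  - by rewrite /pstep se setUC eqxx.
  - by rewrite wp.
  - by move=> f; rewrite inE => /orP[/eqP->|/pG].
  - by move=> x; rewrite inE => /orP[/eqP->|/pb].
have Q0 : Q != set0 by case: critQ.
have W0 : W != set0.
  by case/set0Pn: Q0 => q /(subsetP QW) qW; apply/set0Pn; exists q.
have WV : W \subset V by apply/subsetP => v; rewrite inE => /andP[].
(* An edge of the other colour meeting [W]; without one [W] would be closed
   under all of [G]. *)
have [e1 e1G [v1 v1e [v1W Pe1]]] : exists2 e, e \in G & exists2 v, v \in s e
    & v \in W /\ P e = ~~ b.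
  apply: contrapT => noe.
  have WE : W = V.
    apply: conn => // e eG; case: (boolP [disjoint s e & W]) => [dW|].
      by right; rewrite subsetD dW GV.
    move=> /pred0Pn[v /= /andP[ve vW]]; left.
    apply: (closedW _ v) => //; rewrite inE eG /=; apply/eqP.
    case: (eqVneq (P e) b) => // Pb; case: noe; exists e => //; exists v => //.
    by split=> //; move: Pb; case: (P e); case: (b).
  have [e eG Pe] : exists2 e, e \in G & P e = ~~ b.
    by case: (b); [exists eN|exists eP] => //; apply/negP/negP.
  have /set0Pn[v ve] : s e != set0 by rewrite -cards_eq0 s_pair.
  by case: noe; exists e => //; exists v; rewrite // WE (subsetP (GV _ eG)).
move: v1W; rewrite inE => /andP[_ /asboolP[p [pp up pG pl pb]]].
have Gb_inj : {in Gb &, injective s} by move=> x y /GbG ? /GbG ?; exact: s_inj.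
have Gb2 e : e \in Gb -> #|s e| = 2 by move/GbG/s_pair.
have K0' : #|set0 : {set T}| + K <= K by rewrite cards0.
have [q [sq pq uq qG qQ]] := greedy_walk Gb_inj Gb2 degQ pl K0'.
exists e1, v1, (take K (p ++ q)); split=> //.
have ppq : epath pstep v1 (p ++ q) by rewrite epath_cat pp.
have upq : uniq (v1 :: unzip2 (p ++ q)).
  rewrite /unzip2 map_cat -cat_cons lastI cat_rcons cat_uniq uq andbT.
  move: up; rewrite lastI rcons_uniq => /andP[lN ->].
  rewrite andTb.
  apply/hasPn => x; rewrite inE => /orP[/eqP->|/qQ xQ] //.
  by apply/negP => /pb; move: xQ; rewrite inE => /andP[_ ->].
split.
- by rewrite size_takel // size_cat sq leq_addl.
- by move: ppq; rewrite -{1}(cat_take_drop K (p ++ q)) epath_cat => /andP[].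
- move: upq; rewrite -{1}(cat_take_drop K (p ++ q)) /unzip2 map_cat -cat_cons.
  by rewrite cat_uniq => /andP[].
move=> e; rewrite /unzip1 map_take => /mem_take; rewrite map_cat mem_cat => eb.
have : e \in Gb by case/orP: eb => [/pG|/qG].
by rewrite inE => /andP[-> /eqP->]; rewrite Pe1 negbK.
Qed.
End BichromaticWalk.

(** * Cycles from a dense link *)

Section Hop.
Variables (T : finType) (st : {set T} -> T -> T -> bool).

Lemma epath_take x (p : seq ({set T} * T)) j :
  epath st x p -> epath st x (take j p).
Proof. by rewrite -{1}(cat_take_drop j p) epath_cat => /andP[]. Qed.

(** A Berge path may leave its edge number [j] at any vertex [z] of this edge. *)
Lemma epath_hop x (p : seq ({set T} * T)) j e0 z :
    epath (@bstep T) x p -> j < size p -> z \in (nth e0 p j).1 ->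
  epath (@bstep T) x (rcons (take j p) ((nth e0 p j).1, z)).
Proof.
elim: p x j => [|[e y] p IH] x [|j] //= /andP[/andP[xe ye] pp] jp ze.
  by rewrite /bstep xe ze.
by rewrite {1}/bstep xe ye IH.
Qed.

Lemma unzip1_hop (p : seq ({set T} * T)) j e0 z : j < size p ->
  unzip1 (rcons (take j p) ((nth e0 p j).1, z)) = take j.+1 (unzip1 p).
Proof.
move=> jp; rewrite /unzip1 map_rcons map_take (take_nth e0.1) ?size_map //=.
by rewrite (nth_map e0).
Qed.

Lemma unzip2_hop (p : seq ({set T} * T)) j (e : {set T}) z :
  unzip2 (rcons (take j p) (e, z)) = rcons (take j (unzip2 p)) z.
Proof. by rewrite /unzip2 map_rcons map_take. Qed.

Lemma pstep_bstep (s : {set T} -> {set T}) e u v :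
  s e \subset e -> pstep s e u v -> bstep e u v.
Proof.
by move=> /subsetP se /eqP sE; rewrite /bstep !se // sE !inE eqxx ?orbT.
Qed.
End Hop.

(** Let u_0, u_1, ... be a path in the link graph of [S], with hyperedges
    e_1, e_2, ... A vertex x of [S] lies in all of them, so x, u_1, ..., u_(l-1)
    is a Berge cycle with edges e_1, ..., e_l. A second vertex y of [S] gives one
    more length: insert y between u_(K-1) and x, and go from y to x by another
    hyperedge through u_0. *)
Lemma fan_cycles (T : finType) (E G : {set {set T}}) (S Q : {set T}) K :
    G \subset E -> (forall e, e \in G -> S \subset e /\ #|e :\: S| = 2) ->
    Q != set0 ->
    (forall u, u \in Q ->
      K <= #|[set e in inside (fun e => e :\: S) G Q | u \in e :\: S]|) ->
  (S != set0 -> forall l, 3 <= l <= K -> contains_berge_cycle E l) /\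
  (1 < #|S| -> 1 < K -> contains_berge_cycle E K.+1).
Proof.
move=> /subsetP GE GS /set0Pn[u0 u0Q] deg.
pose s (e : {set T}) := e :\: S.
have s2 e : e \in G -> #|s e| = 2 by case/GS.
have s_inj : {in G &, injective s}.
  move=> e f /GS[Se _] /GS[Sf _] /(congr1 (setU S)).
  by rewrite /s !setDE !setUIr !setUCr !setIT !(setUidPr _).
have K0 : #|set0 : {set T}| + K <= K by rewrite cards0.
have [p [sp pp up pG pQ]] := greedy_walk s_inj s2 deg u0Q K0.
have bp : epath (@bstep T) u0 p.
  by apply: sub_epath pp => e y z _; apply: pstep_bstep; apply: subsetDl.
have ue := epath_uniq_edges pp up.
have Sp x : x \in S -> x \notin unzip2 p.
  move=> xS; elim: (p) (u0) pp pG => [|[e v] p' IH] u //=.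
  move=> /andP[/eqP sE pp'] pG; rewrite inE negb_or.
  have -> : x \notin unzip2 p'.
    by apply: (IH v) => // f fp; apply: pG; rewrite inE fp orbT.
  rewrite andbT; apply/eqP => xv; have : x \in s e.
    by rewrite sE xv !inE eqxx orbT.
  by rewrite inE xS.
have bpx x : x \in S -> epath (@bstep T) x p.
  move=> xS; move: bp pG; case: (p) => [|[e v] p'] //= /andP[/andP[_ ve] ->].
  move=> pG; rewrite andbT /bstep ve andbT.
  by have [/subsetP-> //] := GS e (pG _ (mem_head _ _)).
have pS i x : i < size p -> x \in S -> x \in (nth (set0, u0) p i).1.
  move=> ip xS; have eG : (nth (set0, u0) p i).1 \in G.
    by apply: pG; apply: map_f; apply: mem_nth.
  by have [/subsetP-> //] := GS _ eG.
split.
- case/set0Pn=> x xS l /andP[l3 lK].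
  have lp : l.-1 < size p by lia.
  pose q := rcons (take l.-1 p) ((nth (set0, u0) p l.-1).1, x).
  have -> : l = size q by rewrite size_rcons size_takel; lia.
  apply: (@berge_of_closed_epath _ _ x); rewrite /q ?unzip2_hop ?unzip1_hop //.
  + by rewrite size_rcons size_takel; lia.
  + by apply: epath_hop; rewrite ?bpx ?pS.
  + by rewrite last_rcons.
  + exact: take_uniq.
  + rewrite rcons_uniq take_uniq ?andbT; last by case/andP: up.
    by apply/negP => /mem_take; apply/negP/Sp.
  + by move=> e /mem_take/pG/GE.
- move=> S1 K1.
  have /card_gt1P[x [y [xS yS xy]]] := S1.
  case: K deg K0 sp K1 => [|[|m]] // deg _ sp _.
  have mp : m.+1 < size p by rewrite sp.
  have [e1 [u1 [p' pE]]] : exists e1 u1 p', p = (e1, u1) :: p'.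
    by move: sp; case: (p) => [|[e1 u1] p'] // _; exists e1, u1, p'.
  (* The hyperedge from y back to x: its only other link vertices are u_0, which
     the path has left for good, and a neighbour different from u_1. *)
  have [g gG [u0g ge1]] : exists2 g, g \in G & u0 \in s g /\ g != e1.
    have /card_gt1P[g [h [+ + gh]]] := leq_trans (ltn0Sn m : 1 < m.+2) (deg u0 u0Q).
    rewrite 2![in X in X -> _]inE => /andP[/andP[gG _] u0g].
    rewrite 2![in X in X -> _]inE => /andP[/andP[hG _] u0h].
    case: (eqVneq g e1) => [ge|]; last by exists g.
    by exists h => //; split=> //; rewrite -ge eq_sym.
  have gp : g \notin unzip1 p.
    move: pp up; rewrite pE /= => /andP[_ pp'] /andP[u0N _].
    rewrite inE negb_or ge1 /=; apply/negP => gp; have /subsetP/(_ u0 u0g) := epath_pairs_sub pp' gp.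
    exact/negP.
  pose q := rcons (rcons (take m.+1 p) ((nth (set0, u0) p m.+1).1, y)) (g, x).
  have sq : size q = m.+3 by rewrite /q !size_rcons size_takel // ltnW.
  rewrite -sq.
  have q2 : unzip2 q = rcons (rcons (take m.+1 (unzip2 p)) y) x.
    by rewrite /q /unzip2 map_rcons -/unzip2 unzip2_hop.
  have q1 : unzip1 q = rcons (take m.+1.+1 (unzip1 p)) g.
    by rewrite /q /unzip1 map_rcons -/unzip1 unzip1_hop.
  apply: (@berge_of_closed_epath _ _ x); rewrite ?q1 ?q2 //.
  + by rewrite sq.
  + rewrite /q -cats1 epath_cat epath_hop ?bpx ?pS //= unzip2_hop last_rcons.
    by have [/subsetP gS _] := GS g gG; rewrite /bstep !gS.
  + by rewrite last_rcons.
  + rewrite rcons_uniq take_uniq // andbT.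
    by apply/negP => /mem_take; apply/negP.
  + rewrite !rcons_uniq take_uniq ?andbT; last by case/andP: up.
    rewrite mem_rcons inE negb_or xy /=.
    by apply/andP; split; apply/negP => /mem_take; apply/negP/Sp.
  + by move=> e; rewrite mem_rcons inE => /orP[/eqP->|/mem_take/pG]; exact: GE.
Qed.

(** * Paths between two parts of a tripartite family of triples *)

Lemma epath_vertex_edge (T : finType) (st : {set T} -> T -> T -> bool) v
    (p : seq ({set T} * T)) w :
  epath st v p -> w \in unzip2 p ->
  exists2 e, e \in unzip1 p & exists u, st e u w.
Proof.
elim: p v => [|[e u] p IH] v //= /andP[se pp]; rewrite inE.
move=> /orP[/eqP->|/(IH _ pp)[f fp fw]]; first by exists e; [exact: mem_head|exists v].
by exists f => //; rewrite inE fp orbT.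
Qed.

Lemma card_fiber_bound (I J : finType) (g : I -> J) (M : {set I}) c :
    (forall e, e \in M -> #|[set f in M | g f == g e]| <= c) ->
  #|M| <= c * #|g @: M|.
Proof.
move=> fib; rewrite -sum1_card.
rewrite (partition_big g (fun j => j \in g @: M)) /=; last first.
  by move=> e eM; exact: imset_f.
rewrite mulnC -sum_nat_const; apply: leq_sum => _ /imsetP[e eM ->].
apply: leq_trans (fib e eM); rewrite -sum1_card; apply: eq_leq.
by apply: eq_bigl => f; rewrite inE.
Qed.

Lemma card_gt2_avoid (I : finType) (A : {set I}) a b :
  2 < #|A| -> exists2 c, c \in A & c != a /\ c != b.
Proof.
move=> A3; have : 0 < #|A :\ a :\ b|.
  have := cardsD1 b (A :\ a); have := cardsD1 a A.
  by case: (a \in A); case: (b \in A :\ a); rewrite ?add0n ?add1n; lia.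
by case/card_gt0P => c; rewrite !inE => /and3P[cb ca cA]; exists c.
Qed.

Section Tripartite.
Variable T : finType.
Implicit Types (x y z : {set T} -> T) (M G : {set {set T}}).

(** The functions [x], [y], [z] pick the vertices of the three colours. *)
Definition tripartite x y z M := forall e f, e \in M -> f \in M ->
  [/\ e = [set x e; y e; z e], x e != y f, x e != z f & y e != z f].

Lemma tripartite_swap x y z M : tripartite x y z M -> tripartite x z y M.
Proof.
move=> tr e f eM fM; have [eE xy xz yz] := tr e f eM fM.
split=> //; first by rewrite {1}eE -setUA (setUC [set y e]) setUA.
by have [_ _ _] := tr f e fM eM; rewrite eq_sym.
Qed.

Lemma tripartite_mem x y z M e : tripartite x y z M -> e \in M ->
  [/\ x e \in e, y e \in e & z e \in e].
Proof.
move=> tr eM; have [/setP eE _ _ _] := tr e e eM eM.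
by split; rewrite eE !inE eqxx ?orbT.
Qed.

Variables (R : nat -> T -> T -> Prop) (dmax k : nat).
Hypothesis k2 : 2 <= k.

(** [R d a b] stands for the existence of a Berge path of length [d] from [a] to
    [b] outside of [M]. *)
Definition splits x M := forall X : {set T}, X \subset x @: M -> 1 < #|X| ->
  exists (A : {set T}) d, [/\ d <= dmax, exists2 a, a \in X & a \in A,
    exists2 a, a \in X & a \notin A
    & forall a b, a \in X -> b \in X -> (a \in A) != (b \in A) -> R d a b].

(** Paths inside [M] of [k] consecutive lengths whose ends can all be joined
    back by paths of the same length [d]. *)
Definition connections M := exists2 d, d <= dmax &
  forall j, 1 < j <= k.+1 -> exists a b p, R d b a /\
    [/\ size p = j, epath (@bstep T) a p, last a (unzip2 p) = b
      & [/\ uniq (a :: unzip2 p), uniq (unzip1 p) & {subset unzip1 p <= M}]].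

Definition short_cycles M := forall l, 3 <= l <= k.+2 -> contains_berge_cycle M l.

(** Triples with a common vertex [b] form the link graph of [b], to which
    [fan_cycles] applies. *)
Lemma link_cycles x y z M G V b : tripartite x y z M -> G \subset M ->
    (forall e, e \in G -> x e = b) -> V != set0 ->
    (forall u, u \in V ->
      k.+2 <= #|[set e in inside (fun e => [set y e; z e]) G V |
                  u \in [set y e; z e]]|) ->
  short_cycles M.
Proof.
move=> tr GM xb V0 deg.
have sE e : e \in G -> e :\: [set b] = [set y e; z e].
  move=> eG; have eM := subsetP GM e eG; have [eE xy xz yz] := tr e e eM eM.
  rewrite {1}eE -(xb e eG) -setUA setDUl setDv set0U.
  apply/setDidPl; rewrite disjoint_sym disjoints1 !inE negb_or.
  by rewrite xy xz.
have [||||fan _] := @fan_cycles _ M G [set b] V k.+2 => //.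
- move=> e eG; split; last first.
    rewrite sE // cards2; have eM := subsetP GM e eG.
    by have [_ _ _ ->] := tr e e eM eM.
  rewrite sub1set -(xb e eG); have eM := subsetP GM e eG.
  by have [] := tripartite_mem tr eM.
- move=> u uV; apply: leq_trans (deg u uV) _; apply: subset_leq_card.
  apply/subsetP => e /setIdP[/setIdP[eG eV] ue].
  by apply/setIdP; rewrite sE //; split=> //; apply/setIdP; rewrite sE.
by apply: fan; apply/set0Pn; exists b; rewrite inE.
Qed.

(** The graph has the pairs (y, z) as edges. A path v_1, v_2, ... in it from a
    triple e_1 of one part, using triples of the other part only, gives the Berge
    paths x(e_1), v_1, ..., v_(j-1), x(e_j) for all j: the last triple is left at
    its vertex x instead of v_j. If all triples have the same vertex x,
    there is nothing to split, but then the link graph of x is dense. *)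
Lemma light_pairs_connections x y z M U G :
    tripartite x y z M -> splits x M -> U != set0 ->
    G \subset M -> (forall e, e \in G -> e \subset U) ->
    {in G &, injective (fun e => (y e, z e))} ->
    2 * k.+2 * #|U| <= #|G| ->
  short_cycles M \/ connections M.
Proof.
move=> tr spl U0 GM GU g_inj dG; have /subsetP GMs := GM.
pose s e := [set y e; z e].
have se e : e \in M -> s e \subset e.
  by move=> eM; have [_ ye ze] := tripartite_mem tr eM;
     rewrite subUset !sub1set ye.
have s_inj : {in G &, injective s}.
  move=> e f eG fG sE; apply: g_inj => //.
  have [_ _ _ yz] := tr e f (GMs _ eG) (GMs _ fG).
  have [_ _ _ yz'] := tr f e (GMs _ fG) (GMs _ eG).
  have /set2P[yy|yz0] : y e \in s f by rewrite -sE !inE eqxx.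
  - congr (_, _) => //.
    have /set2P[zy|//] : z e \in s f by rewrite -sE !inE eqxx orbT.
    by rewrite zy eqxx in yz'.
  - by rewrite yz0 eqxx in yz.
have s2 e : e \in G -> #|s e| = 2.
  by move=> /GMs eM; have [_ _ _ yz] := tr e e eM eM; rewrite cards2 yz.
have s0 e : e \in G -> s e != set0 by move=> /s2 h; rewrite -cards_eq0 h.
have [||V VU critV] := @dense_critical_exists _ _ s (2 * k.+2) G U => //.
  apply: leq_trans dG _; apply: subset_leq_card; apply/subsetP => e eG.
  by rewrite inE eG (subset_trans (se _ (GMs _ eG))) ?GU.
set G1 := inside s G V in critV.
have G1G : {subset G1 <= G} by move=> e; rewrite inE => /andP[].
have [V0 dV _] := critV.
have inG1 : inside s G1 V = G1.
  by apply/setP => e; rewrite !inE; case: (e \in G); case: (_ \subset V).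
have G1_gt0 : 0 < #|G1|.
  by apply: leq_trans dV; rewrite muln_gt0 card_gt0 V0.
case: (leqP #|x @: G1| 1) => X1.
  left; have [e0 e0G] : exists e, e \in G1 by apply/card_gt0P.
  apply: (@link_cycles x y z M G1 V (x e0)) => //.
  - by apply/subsetP => e /G1G/GMs.
  - move=> e eG; apply/eqP; move: X1; rewrite leqNgt; apply: contraNT => ne.
    by apply/card_gt1P; exists (x e), (x e0); rewrite ?imset_f.
  - move=> u uV; rewrite -/s inG1.
    by apply: leq_trans (critical_degree critV s0 uV); lia.
right; have [||A [d [dm [a0 a0X a0A] [b0 b0X b0A] RA]]] := spl (x @: G1) => //.
  by apply: imsetS; apply/subsetP => e /G1G/GMs.
exists d => // j /andP[j1 jk].
have s_inj1 : {in G1 &, injective s} by move=> e f /G1G ? /G1G ?; apply: s_inj.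
have [|||||||e1 [v1 [p [e1G v1e [sp pp up pG]]]]] :=
  @bichromatic_walk T s G1 s_inj1 (fun e eG => s2 e (G1G e eG))
    (fun e => x e \in A) k.+2 V => //.
- by move=> e; rewrite inE => /andP[].
- move=> W WV W0 h; apply: (critical_connected critV) => //.
- by case/imsetP: a0X a0A => e eG ->; exists e.
- by case/imsetP: b0X b0A => e eG ->; exists e.
case: j j1 jk => [|[|j]] // _ jk.
have jp : j < size p by rewrite sp; clear -jk; lia.
pose f := (nth (set0, v1) p j).1.
have [fG fA] : f \in G1 /\ (x f \in A) = ~~ (x e1 \in A).
  by apply: pG; apply: map_f; exact: mem_nth.
have fM := GMs _ (G1G _ fG); have e1M := GMs _ (G1G _ e1G).
have xe e : e \in M -> x e \in e.
  by move=> eM; have [] := tripartite_mem tr eM.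
have bp : epath (@bstep T) v1 p.
  apply: sub_epath pp => e u v ep; apply: pstep_bstep.
  by apply: se; apply: GMs; apply: G1G; case: (pG e ep).
have xs a e : a \in M -> e \in M -> x a \notin s e.
  by move=> aM eM; have [_ xy xz _] := tr a e aM eM; rewrite !inE negb_or xy.
have xp a : a \in M -> x a \notin v1 :: unzip2 p.
  move=> aM; rewrite inE negb_or; apply/andP; split.
    by apply: contraNneq (xs a e1 aM e1M) => ->.
  apply/negP => ap; have [e ep [u /eqP sE]] := epath_vertex_edge pp ap.
  have eM : e \in M by apply: GMs; apply: G1G; case: (pG e ep).
  by have := xs a e aM eM; rewrite sE !inE eqxx orbT.
exists (x e1), (x f), ((e1, v1) :: rcons (take j p) (f, x f)); split.
  by apply: RA; rewrite ?imset_f // fA; case: (x e1 \in A).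
have pj : {subset unzip1 (rcons (take j p) (f, x f)) <= unzip1 p}.
  by rewrite unzip1_hop // => e /mem_take.
split=> /=.
- by rewrite size_rcons size_takel // ltnW.
- by rewrite /bstep xe //= (subsetP (se _ e1M)) //= epath_hop // xe.
- by rewrite unzip2_hop last_rcons.
rewrite unzip2_hop unzip1_hop //.
have u2 := up; rewrite cons_uniq in u2; case/andP: u2 => v1N u2.
have xN a : a \in M -> x a \notin take j (unzip2 p).
  move=> aM; apply/negP => /mem_take ap.
  by have := xp a aM; rewrite inE ap orbT.
have xv1 a : a \in M -> x a != v1.
  by move=> aM; apply: contraNneq (xp a aM) => ->; rewrite mem_head.
split.
- rewrite inE !mem_rcons !inE !negb_or rcons_uniq xv1 // !xN // take_uniq //.
  rewrite (eq_sym v1) xv1 // !andbT /=; apply/andP; split.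
    by apply/eqP => h; move: fA; rewrite h; case: (x f \in A).
  by apply/negP => /mem_take; apply/negP.
- rewrite take_uniq ?(epath_uniq_edges pp up) // andbT.
  apply/negP => /mem_take /pG[_].
  by case: (x e1 \in A).
- by move=> e; rewrite inE => /orP[/eqP->|/mem_take/pG[/G1G/GMs]].
Qed.


Lemma walk_alternates (A B : {set T}) (s : {set T} -> {set T}) (v : T)
    (p : seq ({set T} * T)) i :
    (forall e, e \in unzip1 p -> exists a b, [/\ a \in A, b \in B & s e = [set a; b]]) ->
    [disjoint A & B] -> v \in B -> epath (pstep s) v p -> i < size p ->
  nth v (unzip2 p) i \in (if odd i then B else A).
Proof.
elim: p A B v i => [|[e u] p IH] A B v [|i] //= sp dAB vB /andP[/eqP se pp] ip.
all: have uA : u \in A.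
1,3: have [a [b [aA bB]]] := sp e (mem_head _ _).
1,2: rewrite se => sE; have vN : v \notin A by rewrite (disjointFl dAB).
1,2: have vab : v \in [set a; b] by rewrite -sE !inE eqxx.
1,2: have vb : v = b by case/set2P: vab vN => -> //; rewrite aA.
1,2: have : a \in [set v; u] by rewrite sE !inE eqxx.
1,2: by case/set2P => av; [rewrite av vb in aA; rewrite vb aA in vN|rewrite -av].
  exact: uA.
rewrite (set_nth_default u) ?size_map //.
have := IH B A u i _ _ uA pp ip; rewrite if_neg; apply.
  move=> f fp; have [|a [b [aA bB ->]]] := sp f; first by rewrite inE fp orbT.
  by exists b, a; rewrite setUC.
by rewrite disjoint_sym.
Qed.

(** The graph has the pairs (x, y) as edges, and a path in it meets the colour of
    x at every second step, which gives the even lengths only. For the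
    odd lengths the step from v_1 = y(f) to u_1 = x(f), where f is the first
    triple of the path, is replaced by two steps through z(f): the first uses
    a third triple on the pair (y(f), z(f)), the second uses f itself. As no
    vertex of the colour of z is on the path, nothing is repeated. *)
Lemma heavy_pairs_connections x y z M U G :
    tripartite x y z M -> splits x M -> U != set0 ->
    G \subset M -> (forall e, e \in G -> e \subset U) ->
    {in G &, injective (fun e => (x e, y e))} ->
    (forall e, e \in G -> 2 < #|[set f in M | (y f == y e) && (z f == z e)]|) ->
    2 * k * #|U| <= #|G| ->
  connections M.
Proof.
move=> tr spl U0 GM GU g_inj heavy dG; have /subsetP GMs := GM.
pose s e := [set x e; y e].
have se e : e \in M -> s e \subset e.
  by move=> eM; have [xe ye _] := tripartite_mem tr eM;
     rewrite subUset !sub1set xe.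
have s_inj : {in G &, injective s}.
  move=> e f eG fG sE; apply: g_inj => //.
  have [_ xy _ _] := tr e f (GMs _ eG) (GMs _ fG).
  have [_ xy' _ _] := tr f e (GMs _ fG) (GMs _ eG).
  have /set2P[xx|xy0] : x e \in s f by rewrite -sE !inE eqxx.
  - congr (_, _) => //.
    have /set2P[yx|//] : y e \in s f by rewrite -sE !inE eqxx orbT.
    by rewrite yx eqxx in xy'.
  - by rewrite xy0 eqxx in xy.
have s2 e : e \in G -> #|s e| = 2.
  by move=> /GMs eM; have [_ xy _ _] := tr e e eM eM; rewrite cards2 xy.
have s0 e : e \in G -> s e != set0 by move=> /s2 h; rewrite -cards_eq0 h.
have [||V VU critV] := @dense_critical_exists _ _ s (2 * k) G U => //.
  apply: leq_trans dG _; apply: subset_leq_card; apply/subsetP => e eG.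
  by rewrite inE eG (subset_trans (se _ (GMs _ eG))) ?GU.
set G1 := inside s G V in critV.
have G1G : {subset G1 <= G} by move=> e; rewrite inE => /andP[].
have G1M : {subset G1 <= M} by move=> e /G1G/GMs.
have [V0 dV _] := critV.
have k0 : 0 < k by apply: leq_trans k2.
have G1_gt0 : 0 < #|G1|.
  by apply: leq_trans dV; rewrite !muln_gt0 card_gt0 V0 k0.
(* A vertex y has two neighbours in the graph, and these have the colour of x. *)
have X1 : 1 < #|x @: G1|.
  have [e eG] : exists e, e \in G1 by apply/card_gt0P.
  have yV : y e \in V.
    by move: eG; rewrite inE => /andP[_ /subsetP->] //; rewrite !inE eqxx orbT.
  have := critical_degree critV s0 yV; rewrite -/G1 => deg.
  have k1 : 1 < 2 * k by clear -k0; lia.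
  have /card_gt1P[g [h [+ + gh]]] := leq_trans k1 deg.
  move=> /setIdP[gG yg] /setIdP[hG yh].
  apply/card_gt1P; exists (x g), (x h); rewrite ?imset_f //; split=> //.
  have yE f : f \in G1 -> y e \in s f -> y f = y e.
    move=> fG; have [_ xy _ _] := tr f e (G1M _ fG) (G1M _ eG).
    by case/set2P=> h'; [rewrite h' eqxx in xy|].
  apply: contraNneq gh => xgh; apply/eqP; apply: g_inj; rewrite ?G1G //.
  by rewrite xgh !yE.
have [||A [d [dm [a0 a0X a0A] [b0 b0X b0A] RA]]] := spl (x @: G1) => //.
  by apply: imsetS; apply/subsetP => e /G1M.
exists d => // j /andP[j1 jk].
have s_inj1 : {in G1 &, injective s} by move=> e f /G1G ? /G1G ?; apply: s_inj.
have [|||||||e1 [v1 [p [e1G v1e [sp pp up pG]]]]] :=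
  @bichromatic_walk T s G1 s_inj1 (fun e eG => s2 e (G1G e eG))
    (fun e => x e \in A) k V => //.
- by move=> e; rewrite inE => /andP[].
- move=> W WV W0 h; apply: (critical_connected critV) => //.
- by case/imsetP: a0X a0A => e eG ->; exists e.
- by case/imsetP: b0X b0A => e eG ->; exists e.
(* The path stops at vertex number [i] of the walk; the numbering starts at 0, so the
   vertices of the colour of x are those with even number. *)
have [i [ip io ji]] : exists i, [/\ i < k, ~~ odd i & j = (odd j + i).+2].
  exists (j - odd j - 2); clear -j1 jk.
  by case: (boolP (odd j)) => jo /=; split; lia.
have e1M := G1M _ e1G.
have [xe1 ye1 _] := tripartite_mem tr e1M.
have pM e : e \in unzip1 p -> e \in M by move=> /pG[/G1M].
have bp : epath (@bstep T) v1 p.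
  apply: sub_epath pp => e u v ep; apply: pstep_bstep.
  by apply: se; apply: pM.
have xs a e : a \in M -> e \in M -> x a \in s e -> x a = x e.
  move=> aM eM; have [_ xy _ _] := tr a e aM eM.
  by case/set2P => // h; rewrite h eqxx in xy.
have ys a e : a \in M -> e \in M -> y a \in s e -> y a = y e.
  move=> aM eM; have [_ xy _ _] := tr e a eM aM.
  by case/set2P => // h; rewrite h eqxx in xy.
have zs a e : a \in M -> e \in M -> z a \notin s e.
  move=> aM eM; have [_ _ xz _] := tr e a eM aM.
  have [_ _ _ yz] := tr e a eM aM.
  by rewrite !inE negb_or eq_sym xz eq_sym yz.
have xe1p : x e1 \notin unzip2 p.
  apply/negP => ap; have [e ep [u /eqP sE]] := epath_vertex_edge pp ap.
  have [eG] := pG e ep.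
  rewrite -(xs e1 e e1M (G1M _ eG)); first by case: (x e1 \in A).
  by rewrite sE !inE eqxx orbT.
have zp a : a \in M -> z a \notin unzip2 p.
  move=> aM; apply/negP => ap.
  have [e ep [u /eqP sE]] := epath_vertex_edge pp ap.
  by have := zs a e aM (pM _ ep); rewrite sE !inE eqxx orbT.
case: p => [|[f u1] p'] in sp pp up pG bp pM xe1p zp *.
  by move: k0; rewrite -sp.
have fp : f \in unzip1 ((f, u1) :: p') by rewrite mem_head.
have [fG fA] := pG f fp; have fM := G1M _ fG.
have /eqP sf : pstep s f v1 u1 by move: pp => /= /andP[].
have v1f : v1 \in s f by rewrite sf !inE eqxx.
(* The common vertex of triples in different parts cannot have the colour of x. *)
have v1y : v1 = y e1 /\ v1 = y f.
  have v1E : v1 = y e1.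
    case/set2P: v1e => // v1x; rewrite v1x in v1f.
    by move: fA; rewrite -(xs e1 f e1M fM v1f); case: (x e1 \in A).
  by split=> //; rewrite v1E; apply: ys; rewrite // -v1E.
set q := take i.+1 ((f, u1) :: p').
have sq : size q = i.+1 by rewrite size_takel // sp.
have qsub : {subset unzip1 q <= unzip1 ((f, u1) :: p')}.
  by move=> e; rewrite /unzip1 /q map_take => /mem_take.
have qsub2 : {subset unzip2 q <= unzip2 ((f, u1) :: p')}.
  by move=> e; rewrite /unzip2 /q map_take => /mem_take.
have pq : epath (pstep s) v1 q by apply: epath_take.
have bq : epath (@bstep T) v1 q by apply: epath_take.
have uq : uniq (v1 :: unzip2 q).
  rewrite /unzip2 /q map_take; move: up; rewrite cons_uniq => /andP[v1N u2].
  rewrite cons_uniq take_uniq // andbT; apply/negP => /mem_take; exact/negP.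
have dXY : [disjoint x @: M & y @: M].
  rewrite disjoint_subset; apply/subsetP => _ /imsetP[a aM ->].
  rewrite inE; apply/imsetP => -[b bM ab].
  by have [_ + _ _] := tr a b aM bM; rewrite ab eqxx.
have [b [bq1 bG bA]] : exists b, [/\ last v1 (unzip2 q) = x b, b \in G1
    & (x b \in A) = ~~ (x e1 \in A)].
  have lX : last v1 (unzip2 q) \in x @: M.
    have v1Y : v1 \in y @: M by rewrite v1y.1 imset_f.
    have iq : i < size q by rewrite sq.
    have := @walk_alternates (x @: M) (y @: M) s v1 q i _ dXY v1Y pq iq.
    rewrite (negPf io) -nth_last size_map sq; apply.
    move=> e /qsub/pM eM; exists (x e), (y e); split=> //; exact: imset_f.
  have lq : last v1 (unzip2 q) \in unzip2 q by rewrite /q /= mem_last.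
  have [e eq [u /eqP sE]] := epath_vertex_edge pq lq.
  have [eG eA] := pG e (qsub e eq).
  exists e; split=> //; case/imsetP: lX => a aM aE.
  rewrite aE; apply: xs => //; first exact: G1M.
  by rewrite -aE sE !inE eqxx orbT.
have Rba : R d (x b) (x e1).
  by apply: RA; rewrite ?imset_f // bA; case: (x e1 \in A).
exists (x e1), (x b); case: (boolP (odd j)) ji => jo ->; rewrite /= ?add0n ?add1n.
- have [g [gM yg zg ge gf]] : exists g,
      [/\ g \in M, y g = y f, z g = z f, g != e1 & g != f].
    have := heavy f (G1G _ fG); set N := [set _ in M | _] => N3.
    have [g + [ge gf]] := card_gt2_avoid e1 f N3.
    by rewrite inE => /and3P[gM /eqP yg /eqP zg]; exists g.
  have [_ yg' zg'] := tripartite_mem tr gM.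
  have [_ yf zf] := tripartite_mem tr fM.
  have bq' : epath (@bstep T) (z f) q.
    by move: bq; rewrite /q /= /bstep zf => /andP[/andP[_ ->] ->].
  have gq : g \notin unzip1 q.
    rewrite /q /= inE negb_or gf /=; apply/negP => gq.
    move: pp up => /= /andP[_ pp'] /andP[v1N _].
    have gp' : g \in unzip1 p' by move: gq; rewrite /unzip1 map_take => /mem_take.
    have /subsetP/(_ v1) := epath_pairs_sub pp' gp'.
    rewrite v1y.2 -yg !inE eqxx orbT => /(_ isT).
    by rewrite yg -v1y.2; apply/negP.
  clearbody q; exists ((e1, v1) :: (g, z f) :: q); split=> //; split=> /=.
  + by rewrite sq.
  + apply/and3P; split=> //; first by rewrite /bstep xe1 v1y.1.
    by rewrite /bstep v1y.2 -yg yg' -zg zg'.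
  + by rewrite -bq1; case: (q) sq.
  + split.
    * move: uq; rewrite cons_uniq => /andP[v1N uq2].
      have xz : x e1 != z f by have [_ _ -> _] := tr e1 f e1M fM.
      have yz : v1 != z f by rewrite v1y.2; have [_ _ _ ->] := tr f f fM fM.
      have xy : x e1 != v1 by rewrite v1y.1; have [_ -> _ _] := tr e1 e1 e1M e1M.
      rewrite !inE !negb_or xy xz yz v1N uq2 (contra (@qsub2 _) xe1p).
      by rewrite (contra (@qsub2 _) (zp f fM)).
    * rewrite (epath_uniq_edges pq uq) !inE negb_or eq_sym ge andbT /=.
      rewrite gq andbT; apply/negP => /qsub/pG[_].
      by case: (x e1 \in A).
    * by move=> e; rewrite !inE => /or3P[/eqP->|/eqP->|/qsub/pM].
- clearbody q; exists ((e1, v1) :: q); split=> //; split=> //.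
  + by rewrite /= sq.
  + by apply/andP; split; rewrite // /bstep xe1 v1y.1.
  + split.
    * have xy : x e1 != v1 by rewrite v1y.1; have [_ -> _ _] := tr e1 e1 e1M e1M.
      apply/andP; split; last exact: uq.
      by rewrite inE negb_or xy (contra (@qsub2 _) xe1p).
    * apply/andP; split; last exact: epath_uniq_edges pq uq.
      by apply/negP => /qsub/pG[_]; case: (x e1 \in A).
    * by move=> e; rewrite !inE => /orP[/eqP->|/qsub/pM].
Qed.

End Tripartite.

(** * A dense tripartite family of triples *)

Lemma card_pair_image (I J1 J2 : finType) (g : I -> J1) (h : I -> J2)
    (N : {set I}) :
  \sum_(b in g @: N) #|h @: [set e in N | g e == b]|
    <= #|(fun e => (g e, h e)) @: N|.
Proof.
set P := _ @: N; rewrite -[X in _ <= X]sum1_card.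
rewrite (partition_big fst (fun b => b \in g @: N)) /=; last first.
  by move=> _ /imsetP[e eN ->]; exact: imset_f.
apply: leq_sum => b _; rewrite sum1_card.
rewrite -(card_imset _ (fun u v (E : (b, u) = (b, v)) => congr1 snd E)).
apply: subset_leq_card; apply/subsetP => _ /imsetP[_ /imsetP[e + ->] ->].
by rewrite inE => /andP[eN /eqP<-]; rewrite unfold_in /= eqxx andbT imset_f.
Qed.

Section ManyEdges.
Variables (T : finType) (R : nat -> T -> T -> Prop) (dmax k : nat).
Hypothesis k2 : 2 <= k.
Implicit Types (x y z : {set T} -> T) (M N : {set {set T}}).

(** A link graph with many edges per vertex contains a subgraph of large minimum
    degree. *)
Lemma sparse_link x y z M N b :
    tripartite x y z M -> N \subset M -> N != set0 ->
    (forall e, e \in N -> x e = b) ->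
  short_cycles k M \/ #|N| <= k.+2 * (#|y @: N| + #|z @: N|).
Proof.
move=> tr NM N0 xb; pose V := y @: N :|: z @: N.
case: (leqP (k.+2 * #|V|) #|N|) => [dN|sN]; last first.
  right; apply: leq_trans (ltnW sN) _; rewrite leq_mul2l /=.
  by rewrite cardsU leq_subr.
left; pose s e := [set y e; z e].
have V0 : V != set0.
  by have /set0Pn[e eN] := N0; apply/set0Pn; exists (y e); rewrite inE imset_f.
have [|W WV critW] := @dense_critical_exists _ _ s k.+2 N V V0.
  apply: leq_trans dN _; apply: subset_leq_card; apply/subsetP => e eN.
  by rewrite inE eN subUset !sub1set !inE !imset_f ?orbT.
have [W0 _ _] := critW.
apply: (link_cycles tr NM xb W0) => u uW; apply: (critical_degree critW) => //.
by move=> e _; apply/set0Pn; exists (y e); rewrite !inE eqxx.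
Qed.

(** Summing [sparse_link] over all vertices x: the edges of the link of x are the
    triples through x, and its vertices are the pairs (x, y) and (x, z). *)
Lemma cycles_or_pairs x y z M N :
    tripartite x y z M -> N \subset M ->
  short_cycles k M \/
  #|N| <= k.+2 * (#|(fun e => (x e, y e)) @: N| + #|(fun e => (x e, z e)) @: N|).
Proof.
move=> tr NM; have [|nc] := pselect (short_cycles k M); first by left.
right; pose F b := [set e in N | x e == b].
have -> : #|N| = \sum_(b in x @: N) #|F b|.
  rewrite -sum1_card (partition_big x (fun b => b \in x @: N)) /=; last first.
    by move=> e eN; exact: imset_f.
  apply: eq_bigr => b _; rewrite -sum1_card; apply: eq_bigl => e.
  by rewrite inE.
apply: leq_trans (leq_mul (leqnn _) (leq_add (card_pair_image x y N)
  (card_pair_image x z N))).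
rewrite -big_split big_distrr /=; apply: leq_sum => _ /imsetP[e eN ->].
have [||||//] := @sparse_link x y z M (F (x e)) (x e) tr.
- by apply: subset_trans NM; apply/subsetP => f; rewrite inE => /andP[].
- by apply/set0Pn; exists e; rewrite inE eN eqxx.
- by move=> f; rewrite inE => /andP[_ /eqP].
- by [].
Qed.

(** Triples are sorted by the number of triples on their pair (y, z). The constant
    32 leaves enough after halving the triples, choosing representatives and
    losing a factor 2(k+2) <= 4k in [cycles_or_pairs]. *)
Lemma cycles_or_connections x y z M (U : {set T}) :
    tripartite x y z M -> splits R dmax x M -> U != set0 ->
    (forall e, e \in M -> e \subset U) -> 32 * k ^ 2 * #|U| <= #|M| ->
  short_cycles k M \/ connections R dmax k M.
Proof.
move=> tr spl U0 MU dM.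
pose cod e := [set f in M | (y f == y e) && (z f == z e)].
pose L := [set e in M | #|cod e| <= 2]; pose H := [set e in M | 2 < #|cod e|].
have LM : L \subset M by apply/subsetP => e; rewrite inE => /andP[].
have HM : H \subset M by apply/subsetP => e; rewrite inE => /andP[].
have LH : #|M| <= #|L| + #|H|.
  rewrite -cardsUI; apply: leq_trans (leq_addr _ _); apply: subset_leq_card.
  by apply/subsetP => e eM; rewrite !inE eM /=; case: leqP.
case: (leqP (16 * k ^ 2 * #|U|) #|L|) => [dL|dL].
  have [G GL [G_inj GE]] := representatives (fun e => (y e, z e)) L.
  have GM := subset_trans GL LM.
  apply: (light_pairs_connections k2 tr spl U0 GM _ G_inj).
    by move=> e eG; apply: MU; apply: (subsetP GM).
  have : #|L| <= 2 * #|G|.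
    rewrite -(card_in_imset G_inj) GE; apply: card_fiber_bound => e.
    rewrite inE => /andP[_ h]; apply: leq_trans h; apply: subset_leq_card.
    by apply/subsetP => f; rewrite !inE xpair_eqE => /andP[/andP[-> _]].
  have hk : 4 * k.+2 <= 16 * k ^ 2 by rewrite -mulnn; clear -k2; nia.
  have := leq_trans (leq_mul hk (leqnn #|U|)) dL.
  by rewrite -!mulnA; move: (k.+2 * _) #|L| #|G| => a b c; clear; lia.
have dH : 16 * k ^ 2 * #|U| <= #|H| by clear -dL dM LH; nia.
have heavyH e : e \in H -> 2 < #|cod e| by rewrite inE => /andP[].
have [|pairs] := cycles_or_pairs tr HM; first by left.
right; case: (leqP (2 * k * #|U|) #|(fun e => (x e, y e)) @: H|) => [dxy|dxy].
  have [G GH [G_inj GE]] := representatives (fun e => (x e, y e)) H.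
  have GM := subset_trans GH HM.
  apply: (heavy_pairs_connections k2 tr spl U0 GM _ G_inj).
  - by move=> e eG; apply: MU; apply: (subsetP GM).
  - by move=> e /(subsetP GH)/heavyH.
  - by rewrite -(card_in_imset G_inj) GE.
have [G GH [G_inj GE]] := representatives (fun e => (x e, z e)) H.
have GM := subset_trans GH HM.
apply: (heavy_pairs_connections k2 (tripartite_swap tr) spl U0 GM _ G_inj).
- by move=> e eG; apply: MU; apply: (subsetP GM).
- move=> e /(subsetP GH)/heavyH h; apply: leq_trans h _; apply: subset_leq_card.
  by apply/subsetP => f; rewrite !inE andbC => /andP[/andP[-> ->] ->].
- rewrite -(card_in_imset G_inj) GE.
  have hk : 4 * k * k.+2 <= 16 * k ^ 2 by rewrite -mulnn; clear -k2; nia.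
  rewrite leqNgt; apply/negP => dxz.
  have two_small := leq_add dxy dxz.
  have := leq_trans (leq_mul hk (leqnn #|U|)) dH.
  rewrite leqNgt => /negP; apply; apply: leq_ltn_trans pairs _.
  have -> : 4 * k * k.+2 * #|U| = k.+2 * (2 * k * #|U| + 2 * k * #|U|).
    by clear; lia.
  by rewrite ltn_pmul2l //; apply: leq_trans two_small; rewrite addSn addnS.
Qed.
End ManyEdges.

(** * Balls, spheres and joining paths *)

Section Balls.
Variables (T : finType) (H : {set {set T}}) (r : T).
Implicit Types (e : {set T}) (u v a b : T).

(** [ball n] consists of the vertices at distance less than [n] from the root, so
    that [sphere n] is the set of vertices at distance exactly [n], for n = 0
    as well. *)
Fixpoint ball n : {set T} :=
  if n is n'.+1 then
    r |: (ball n' :|: \bigcup_(e in H | ~~ [disjoint e & ball n']) e)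
  else set0.

Arguments ball : simpl never.

Definition sphere n := ball n.+1 :\: ball n.

(** The edges whose vertex closest to the root is at distance [n]. *)
Definition layer n :=
  [set e in H | [disjoint e & ball n] && ~~ [disjoint e & ball n.+1]].

Lemma ballS n : ball n \subset ball n.+1.
Proof. by apply/subsetP => v vb; apply/setU1P; right; apply/setUP; left. Qed.

Lemma ball_closed n e : e \in H -> ~~ [disjoint e & ball n] -> e \subset ball n.+1.
Proof.
move=> eH en; apply: subset_trans (subsetUr _ _); apply: subset_trans (subsetUr _ _).
by apply: bigcup_sup; rewrite eH en.
Qed.

Lemma root_ball n : r \in ball n.+1.
Proof. exact: setU11. Qed.

Lemma ball1 : ball 1 = [set r].
Proof.
rewrite /ball big_pred0 ?setU0 // => e; case: (e \in H) => //=.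
by apply/negbTE; rewrite negbK disjoint_sym disjoint_subset; apply/subsetP => v; rewrite inE.
Qed.

Lemma sphere_parent n v : v \in sphere n.+1 ->
  exists e u, [/\ e \in H, v \in e, u \in e, u \in sphere n & [disjoint e & ball n]].
Proof.
rewrite inE => /andP[vN] /setU1P[vr|/setUP[vn|]].
- by rewrite vr root_ball in vN.
- by rewrite vn in vN.
case/bigcupP => e /andP[eH en] ve.
have en' : [disjoint e & ball n].
  by apply: contraNT vN => /(ball_closed eH)/subsetP; apply.
case/pred0Pn: en => u /= /andP[ue un]; exists e, u; split=> //.
by rewrite inE un (disjointFr en').
Qed.

(** Joining paths that avoid the spheres from [n] on, except at their ends, and
    use only edges of layers below [n]; they can be combined with any path
    inside the layer [n]. *)
Definition below n d a b := exists q : seq ({set T} * T),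
  [/\ size q = d, epath (@bstep T) a q, last a (unzip2 q) = b
    & [/\ uniq (a :: unzip2 q), uniq (unzip1 q),
          forall u, u \in unzip2 q -> u \in ball n \/ u = b
        & forall e, e \in unzip1 q -> e \in H /\ ~~ [disjoint e & ball n]]].

Hypothesis H3 : forall e, e \in H -> #|e| = 3.

(** Every vertex chooses a parent one level lower and an edge containing both. If
    the vertices of [X] have different parents, split the parents by induction
    and prolong the paths at both ends. If they have the same parent but not the
    same edge, split by the edge and join by two edges through the parent.
    If they have the same parent and edge, this edge joins them directly. *)
Lemma sphere_splits n (X : {set T}) : X \subset sphere n -> 1 < #|X| ->
  exists (A : {set T}) d, [/\ d <= 2 * n, exists2 a, a \in X & a \in A,
    exists2 a, a \in X & a \notin A
    & forall a b, a \in X -> b \in X -> (a \in A) != (b \in A) -> below n d a b].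
Proof.
elim: n X => [|n IH] X XS X1.
  move: X1; rewrite ltnNge => /negP[]; rewrite -(cards1 r).
  by apply: subset_leq_card; apply: subset_trans XS _; rewrite -ball1 subsetDl.
have /choice[tp tpP] x : exists eu : {set T} * T, x \in sphere n.+1 ->
    [/\ eu.1 \in H, x \in eu.1, eu.2 \in eu.1, eu.2 \in sphere n
      & [disjoint eu.1 & ball n]].
  case: (boolP (x \in sphere n.+1)) => [/sphere_parent[e [u h]]|_].
    by exists (e, u).
  by exists (set0, r).
pose t x := (tp x).1; pose par x := (tp x).2.
have tH x : x \in X -> t x \in H by move=> /(subsetP XS)/tpP[].
have xt x : x \in X -> x \in t x by move=> /(subsetP XS)/tpP[].
have pt x : x \in X -> par x \in t x by move=> /(subsetP XS)/tpP[].
have pS x : x \in X -> par x \in sphere n by move=> /(subsetP XS)/tpP[].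
have td x : x \in X -> [disjoint t x & ball n] by move=> /(subsetP XS)/tpP[].
have pB x : x \in X -> par x \in ball n.+1 by move=> /pS; rewrite inE => /andP[].
have pN x : x \in X -> par x \notin ball n by move=> /pS; rewrite inE => /andP[].
have xN x : x \in X -> x \notin ball n.+1.
  by move=> /(subsetP XS); rewrite inE => /andP[].
have tm x : x \in X -> ~~ [disjoint t x & ball n.+1].
  by move=> xX; apply/pred0Pn; exists (par x); rewrite /= pt // pB.
have xp x u : x \in X -> u \in ball n.+1 -> x != u.
  by move=> xX; apply: contraTneq => <-; exact: xN.
case: (leqP #|par @: X| 1) => P1; last first.
  have [|A [d [dn [a0 a0P a0A] [b0 b0P b0A] hA]]] := IH (par @: X) _ P1.
    by apply/subsetP => _ /imsetP[x xX ->]; exact: pS.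
  exists (par @^-1: A), d.+2; split.
  - by rewrite mulnS; clear -dn; lia.
  - by case/imsetP: a0P a0A => x xX ->; exists x; rewrite ?inE.
  - by case/imsetP: b0P b0A => x xX ->; exists x; rewrite ?inE.
  move=> a b aX bX; rewrite !inE => ab.
  have [q [sq pq lq [uq ueq vq eq]]] :=
    hA _ _ (imset_f par aX) (imset_f par bX) ab.
  have pab : par a != par b by apply: contraNneq ab => ->.
  have ab' : a != b by apply: contraNneq ab => ->.
  have qB u : u \in par a :: unzip2 q -> u \in ball n.+1.
    rewrite inE => /orP[/eqP->|/vq[|->]]; rewrite ?pB //.
    exact/subsetP/ballS.
  have tq x : x \in X -> t x \notin unzip1 q.
    by move=> xX; apply/negP => /eq[_]; rewrite td.
  exists ((t a, par a) :: rcons q (t b, b)); split.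
  - by rewrite /= size_rcons sq.
  - rewrite /= -cats1 epath_cat pq lq /= /bstep xt // !pt // xt //.
  - by rewrite /= /unzip2 map_rcons last_rcons.
  - rewrite /unzip1 /unzip2 !map_cons !map_rcons; split.
    + have aq : a \notin par a :: unzip2 q by apply: contra (xN a aX); exact: qB.
      have bq : b \notin par a :: unzip2 q by apply: contra (xN b bX); exact: qB.
      have uB : uniq (rcons (par a :: unzip2 q) b) by rewrite rcons_uniq bq.
      have aB : a \notin rcons (par a :: unzip2 q) b.
        by rewrite mem_rcons inE negb_or ab'.
      by apply/andP; split; [exact: aB|exact: uB].
    + have uB : uniq (rcons (unzip1 q) (t b)) by rewrite rcons_uniq ueq tq.
      suff tab : t a != t b.
        have aB : t a \notin rcons (unzip1 q) (t b).
          by rewrite mem_rcons inE negb_or tab tq.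
        by apply/andP; split; [exact: aB|exact: uB].
      apply/eqP => tab.
      (* An edge with two vertices on this level and different parents would have four
         vertices. *)
      have u4 : uniq [:: a; b; par a; par b].
        by rewrite /= !inE !negb_or ab' pab !xp ?pB.
      have : #|[:: a; b; par a; par b]| <= #|t a|.
        apply: subset_leq_card; apply/subsetP/allP => /=.
        by rewrite xt // pt //= {1}tab xt // {1}tab pt.
      by rewrite (card_uniqP u4) H3 ?tH.
    + move=> u; rewrite inE mem_rcons inE.
      by case/or3P => [/eqP->|/eqP->|uq']; [left; rewrite pB|right|
        left; apply: qB; rewrite inE uq' orbT].
    + move=> e; rewrite inE mem_rcons inE.
      case/or3P => [/eqP->|/eqP->|/eq[eH en]]; rewrite ?tH ?tm //; split=> //.
      by apply: contraNN en; apply: disjointWr; exact: ballS.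
have parE a b : a \in X -> b \in X -> par a = par b.
  move=> aX bX; apply/eqP; move: P1; rewrite leqNgt; apply: contraNT => ne.
  by apply/card_gt1P; exists (par a), (par b); rewrite !imset_f.
have [x0 x0X] : exists x, x \in X by apply/card_gt0P; apply: ltnW.
case: (boolP [exists x in X, t x != t x0]) => [/exists_inP[x1 x1X t1]|].
  exists [set x | t x == t x0], 2; split.
  - by rewrite mulnS.
  - by exists x0; rewrite ?inE.
  - by exists x1; rewrite ?inE.
  move=> a b aX bX; rewrite !inE => tab.
  have ab : a != b by apply: contraNneq tab => ->.
  have tab' : t a != t b by apply: contraNneq tab => ->.
  exists [:: (t a, par a); (t b, b)]; split=> //=.
    by rewrite /bstep xt ?pt ?xt ?(parE a b) ?pt.
  split.
  - have ap : a != par a by rewrite xp ?pB.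
    have pb : par a != b by rewrite eq_sym xp ?pB.
    by rewrite !inE !negb_or ab ap pb.
  - by rewrite inE tab'.
  - move=> u uq; have /orP[/eqP->|/eqP->] : (u == par a) || (u == b).
    + by move: uq; rewrite !inE.
    + by left; exact: pB.
    + by right.
  - by move=> e; rewrite !inE => /orP[] /eqP->; rewrite ?tH ?tm.
rewrite negb_exists => /forallP tE.
have {}tE x : x \in X -> t x = t x0.
  by move=> xX; have := tE x; rewrite xX /= negbK => /eqP.
have [x1 x1X x10] : exists2 x, x \in X & x != x0.
  have /card_gt1P[x [y [xX yX xy]]] := X1.
  by case: (eqVneq x x0) => [xE|]; [exists y; rewrite // eq_sym -xE|exists x].
exists [set x0], 1; split.
- by rewrite mulnS.
- by exists x0; rewrite ?inE.
- by exists x1; rewrite ?inE.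
move=> a b aX bX; rewrite !inE => ab0.
have ab : a != b by apply: contraNneq ab0 => ->.
exists [:: (t a, b)]; split=> //=.
  by rewrite /bstep xt // (tE a) // -(tE b) // xt.
split=> //.
- by rewrite inE ab.
- by move=> u; rewrite inE => /eqP->; right.
- by move=> e; rewrite inE => /eqP->; rewrite tH ?tm.
Qed.

End Balls.

(** * Layers with many edges, and rainbow edges *)

(** The arithmetic of one level: [s], [t], [u] are the sizes of the current, the
    next and the previous sphere, and [l], [l'] those of the current and the
    previous layer. *)
Lemma growth_step D q s t u l l' : 0 < D ->
    3 * D * (q + 4) * s <= 3 * (l + l') -> l < D * (s + t) ->
    l' <= D * (u + s) -> u <= s ->
  q.+1 * s <= t.
Proof.
move=> D0; rewrite -!mulnA leq_pmul2l // => dl lt l'u us.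
have : D * ((q + 4) * s) <= D * (s + t + (u + s)).
  by apply: leq_trans dl _; rewrite mulnDr leq_add // ltnW.
rewrite leq_pmul2l //; move: us; rewrite mulSn mulnDl; clear; lia.
Qed.

Section Growth.
Variables (T : finType) (H : {set {set T}}) (r : T).
Hypothesis H3 : forall e, e \in H -> #|e| = 3.
Local Notation ball := (ball H r).
Local Notation sphere := (sphere H r).
Local Notation layer := (layer H r).

Lemma degree_sum (S : {set T}) :
  \sum_(v in S) #|[set e in H | v \in e]|
    <= 3 * #|[set e in H | ~~ [disjoint e & S]]|.
Proof.
have -> : \sum_(v in S) #|[set e in H | v \in e]| = \sum_(e in H) #|e :&: S|.
  transitivity (\sum_(v in S) \sum_(e in H | v \in e) 1).
    apply: eq_bigr => v _; rewrite -sum1_card; apply: eq_bigl => e.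
    by rewrite inE.
  rewrite (exchange_big_dep (mem H)) /=; last by move=> v e _ /andP[].
  apply: eq_bigr => e eH; rewrite -sum1_card; apply: eq_bigl => v.
  by rewrite inE eH andbC.
rewrite mulnC -sum_nat_const big_mkcond [X in _ <= X]big_mkcond /=.
apply: leq_sum => e _; rewrite inE; case: (boolP (e \in H)) => //= eH.
case: (boolP [disjoint e & S]) => /=.
  by rewrite -setI_eq0 => /eqP->; rewrite cards0.
by move=> _; rewrite -(H3 eH); apply: subset_leq_card; exact: subsetIl.
Qed.

(** The edges meeting sphere i belong to the layers i and i-1. If these are
    sparse, the degrees on sphere i can only be accounted for by a sphere i+1 at
    least q+1 times as large, so that sphere h has at least (q+1)^h vertices. *)
Lemma heavy_layer (V : {set T}) D q delta h :
    (forall e, e \in H -> e \subset V) -> r \in V ->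
    (forall v, v \in V -> delta <= #|[set e in H | v \in e]|) ->
    0 < D -> 3 * D * (q + 4) <= delta -> 0 < h -> #|V| <= q ^ h ->
  exists2 i, i < h & sphere i != set0 /\
    D * (#|sphere i| + #|sphere i.+1|) <= #|layer i|.
Proof.
move=> HV rV deg D0 dq h0 Vq; apply: contrapT => light.
have ballV n : ball n \subset V.
  elim: n => [|n IH]; first exact: sub0set.
  rewrite subUset sub1set rV subUset IH /=; apply/bigcupsP => e /andP[eH _].
  exact: HV.
have meet i e : e \in H -> ~~ [disjoint e & sphere i] ->
    e \in layer i \/ exists2 j, i = j.+1 & e \in layer j.
  move=> eH /pred0Pn[v /= /andP[ve]]; rewrite inE => /andP[vN vS].
  have eS : ~~ [disjoint e & ball i.+1].
    by apply/pred0Pn; exists v; rewrite /= ve.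
  case: (boolP [disjoint e & ball i]) => ei; first by left; rewrite inE eH ei.
  case: i vN vS eS ei => [|j] vN vS eS ei.
    by move/negP: ei; case; rewrite disjoint_sym disjoint_subset; apply/subsetP => u;
       rewrite inE.
  right; exists j => //; rewrite inE eH ei andbT; apply: contraNT vN.
  by move/(ball_closed eH)/subsetP; apply.
(* There is no layer before layer 0. *)
pose prev i := if i is j.+1 then #|layer j| else 0.
have count i : delta * #|sphere i| <= 3 * (#|layer i| + prev i).
  have SV : sphere i \subset V by apply: subset_trans (ballV i.+1); exact: subsetDl.
  apply: (@leq_trans (\sum_(v in sphere i) #|[set e in H | v \in e]|)).
    rewrite mulnC -sum_nat_const; apply: leq_sum => v vS; apply: deg.
    exact: (subsetP SV).
  apply: leq_trans (degree_sum _) _; rewrite leq_mul2l /=.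
  pose L := if i is j.+1 then layer j else set0.
  have -> : prev i = #|L| by rewrite /prev /L; case: (i); rewrite ?cards0.
  apply: leq_trans (_ : #|layer i :|: L| <= _); last by rewrite cardsU leq_subr.
  apply: subset_leq_card; apply/subsetP => e /setIdP[eH /(meet i e eH) h'].
  apply/setUP; case: h' => [|[j ij ej]]; [by left|right].
  by rewrite /L ij.
have light_layer i : i < h -> sphere i != set0 ->
    #|layer i| < D * (#|sphere i| + #|sphere i.+1|).
  by move=> ih iS; rewrite ltnNge; apply/negP => iL; apply: light; exists i.
have grow i : i < h -> sphere i != set0 /\ q.+1 * #|sphere i| <= #|sphere i.+1|.
  elim: i => [|i IH] ih.
    have s0 : sphere 0 != set0.
      by apply/set0Pn; exists r; rewrite inE root_ball inE.
    split; first exact: s0.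
    apply: (@growth_step D q _ _ 0 #|layer 0| 0) => //.
    - by apply: leq_trans (count 0); rewrite leq_mul.
    - exact: light_layer.
  have [iS iq] := IH (ltnW ih); have i0 : 0 < #|sphere i| by rewrite card_gt0.
  have s1 : sphere i.+1 != set0.
    by rewrite -card_gt0; apply: leq_trans iq; rewrite muln_gt0.
  split; first exact: s1.
  apply: (@growth_step D q _ _ #|sphere i| #|layer i.+1| #|layer i|) => //.
  - by apply: leq_trans (count i.+1); rewrite leq_mul.
  - exact: light_layer.
  - by rewrite ltnW // light_layer // ltnW.
  - by apply: leq_trans iq; rewrite mulSn leq_addr.
have power i : i <= h -> q.+1 ^ i <= #|sphere i|.
  elim: i => [|i IH] ih.
    by rewrite expn0 card_gt0; apply/set0Pn; exists r; rewrite inE root_ball inE.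
  have [_] := grow i ih; apply: leq_trans; rewrite expnS leq_mul2l IH ?orbT //.
  exact: ltnW.
have hV : #|sphere h| <= #|V|.
  by apply: subset_leq_card; apply: subset_trans (ballV h.+1); exact: subsetDl.
have := leq_trans (leq_trans (power h (leqnn h)) hV) Vq.
by rewrite leqNgt ltn_exp2r // ltnSn.
Qed.
End Growth.

(** In a uniformly random colouring a given triple is rainbow with probability at
    least 1/27: overwriting the colours of its three vertices by 0, 1, 2, and
    remembering the old ones, is injective. *)
Lemma rainbow_colouring (T : finType) (E : {set {set T}}) :
    (forall e, e \in E -> #|e| = 3) ->
  exists f : {ffun T -> 'I_3},
    #|E| <= 27 * #|[set e in E | [forall c, exists v in e, f v == c]]|.
Proof.
move=> E3; apply: contrapT => none.
pose good (f : {ffun T -> 'I_3}) (e : {set T}) := [forall c, exists v in e, f v == c].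
pose N := #|{: {ffun T -> 'I_3}}|.
have many e : e \in E -> N <= 27 * #|[set f | good f e]|.
  move=> eE; have e3 := E3 e eE.
  have [a [b [c [eE' ab ac bc]]]] : exists a b c,
      [/\ e = [set a; b; c], a != b, a != c & b != c].
    have /card_gt2P[a [b [c [[ae be ce] [ab bc ca]]]]] : 2 < #|e| by rewrite e3.
    have ac : a != c by rewrite eq_sym.
    exists a, b, c; split=> //; apply/esym/eqP.
    rewrite eqEcard !subUset !sub1set ae be ce e3 -setUA !cardsU1 !inE cards1.
    by rewrite negb_or ab ac bc.
  (* Recolours the three vertices of the triple by 0, 1, 2. *)
  pose rec (f : {ffun T -> 'I_3}) : {ffun T -> 'I_3} := [ffun v =>
    if v == a then ord0 else if v == b then inord 1
    else if v == c then inord 2 else f v].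
  pose F (f : {ffun T -> 'I_3}) := (rec f, ((f a, f b), f c)).
  have F_inj : injective F.
    move=> f g [/ffunP fg fa fb fc]; apply/ffunP => v; have := fg v.
    by rewrite !ffunE; do 3!case: eqP => [->|_] //.
  have -> : N = #|[set F f | f : {ffun T -> 'I_3}]| by rewrite card_imset.
  have -> : 27 = #|[set: 'I_3 * 'I_3 * 'I_3]|.
    by rewrite cardsT !card_prod card_ord.
  rewrite mulnC -cardsX; apply: subset_leq_card; apply/subsetP => _ /imsetP[f _ ->].
  rewrite !inE andbT; apply/forallP => i; apply/exists_inP.
  case: (ltngtP (val i) 1) => i1.
  - exists a; first by rewrite eE' !inE eqxx.
    by rewrite ffunE eqxx; apply/eqP/val_inj; move: i1; rewrite ltnS leqn0 => /eqP->.
  - exists c; first by rewrite eE' !inE eqxx orbT.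
    rewrite ffunE (eq_sym c) (negPf ac) (eq_sym c) (negPf bc) eqxx.
    apply/eqP/val_inj; rewrite /= inordK //; apply/eqP.
    by rewrite eqn_leq i1 -ltnS ltn_ord.
  - exists b; first by rewrite eE' !inE eqxx orbT.
    rewrite ffunE (eq_sym b) (negPf ab) eqxx.
    by apply/eqP/val_inj; rewrite /= inordK.
have few f : 27 * #|[set e in E | good f e]| < #|E|.
  by rewrite ltnNge; apply/negP => h; apply: none; exists f.
have [e0 e0E] : exists e, e \in E.
  by apply/card_gt0P; apply: leq_trans (few [ffun=> ord0]).
have N0 : 0 < N by apply/card_gt0P; exists [ffun=> ord0].
have : \sum_(f : {ffun T -> 'I_3}) 27 * #|[set e in E | good f e]| < N * #|E|.
  apply: (@leq_ltn_trans (\sum_(f : {ffun T -> 'I_3}) #|E|.-1)).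
    by apply: leq_sum => f _; rewrite -ltnS prednK // (cardD1 e0) e0E.
  by rewrite sum_nat_const ltn_pmul2l // prednK // (cardD1 e0) e0E.
suff : N * #|E| <= \sum_(f : {ffun T -> 'I_3}) 27 * #|[set e in E | good f e]|.
  by rewrite leqNgt => /negP.
have -> : \sum_f 27 * #|[set e in E | good f e]|
    = \sum_(e in E) 27 * #|[set f | good f e]|.
  rewrite -!big_distrr /=; congr (_ * _).
  transitivity (\sum_f \sum_(e in E | good f e) 1).
    by apply: eq_bigr => f _; rewrite -sum1_card; apply: eq_bigl => e; rewrite inE.
  rewrite (exchange_big_dep (mem E)) /=; last by move=> f e _ /andP[].
  apply: eq_bigr => e eE; rewrite -sum1_card; apply: eq_bigl => f.
  by rewrite inE eE.
by rewrite mulnC -sum_nat_const; apply: leq_sum => e; exact: many.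
Qed.

(** * The 3-uniform case *)

Lemma contains_berge_cycleS (T : finType) (M E : {set {set T}}) l :
  M \subset E -> contains_berge_cycle M l -> contains_berge_cycle E l.
Proof. by move=> ME [C CM]; exists C; first exact: subset_trans ME. Qed.

(** The two paths share no inner vertex and no edge, because one of them stays
    in balls which the other one avoids. *)
Lemma cycles_through_tree (T : finType) (H M : {set {set T}}) (r : T) i k :
    M \subset layer H r i -> connections (below H r i) (2 * i) k M ->
  exists2 a, a <= (2 * i).+2 &
    forall l, a <= l < a + k -> contains_berge_cycle H l.
Proof.
move=> /subsetP ML [d di con]; exists d.+2 => // l /andP[l1 l2].
have MB e : e \in M -> e \in H /\ [disjoint e & ball H r i].
  by move/ML; rewrite inE => /andP[-> /andP[->]].
have jk : 1 < l - d <= k.+1 by clear -l1 l2; lia.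
have [a [b [p [[q [sq bq lq [uq ueq vq eq]]] [sp bp lp [up uep pM]]]]]] := con _ jk.
have p2 : 1 < size p by rewrite sp; case/andP: jk.
have ab : a != b.
  apply: contraTneq up => ab; rewrite cons_uniq negb_and negbK {1}ab -lp.
  by case: (p) p2 => [|[e u] p'] //= _; rewrite mem_last.
have d0 : 0 < d by rewrite -sq; case: (q) lq ab => [/= ->|//]; rewrite eqxx.
have -> : l = size (p ++ q) by rewrite size_cat sp sq subnK //; clear -l1; lia.
(* The only vertex outside the ball that the joining path enters is its end [a],
   the start of the path in [M]. *)
have disj : ~~ has (mem (unzip2 p)) (unzip2 q).
  apply/hasPn => v /vq[vi|->]; last by case/andP: up.
  apply/negP => vp; have [e ep [u /andP[_ ve]]] := epath_vertex_edge bp vp.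
  by have [_ /disjointFr/(_ ve)] := MB e (pM e ep); rewrite vi.
have disj' : ~~ has (mem (unzip1 p)) (unzip1 q).
  apply/hasPn => e /eq[_ ei]; apply/negP => ep.
  by have [_ ei'] := MB e (pM e ep); rewrite ei' in ei.
move: up uq; rewrite !cons_uniq => /andP[aN up] /andP[bN uq].
apply: (@berge_of_closed_epath _ _ a).
- by rewrite size_cat; clear -p2 d0 sq; lia.
- by rewrite epath_cat bp lp bq.
- by rewrite /unzip2 map_cat last_cat -/unzip2 lp.
- by rewrite /unzip1 map_cat cat_uniq uep ueq andbT.
- by rewrite /unzip2 map_cat cat_uniq up uq andbT.
- move=> e; rewrite /unzip1 map_cat mem_cat => /orP[/pM/MB[]//|/eq[]//].
Qed.

Lemma color_triple (c : 'I_3) : exists c2 c3, [/\ c != c2, c != c3 & c2 != c3].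
Proof.
have /card_gt1P[c2 [c3 [+ + c23]]] : 1 < #|[set~ c]|.
  by rewrite cardsC1 card_ord.
by rewrite !inE !(eq_sym _ c) => n2 n3; exists c2, c3.
Qed.

Lemma three_uniform_cycles (T : finType) (E : {set {set T}}) h k q :
    (forall e, e \in E -> #|e| = 3) -> 2 <= h -> 2 <= k -> 0 < #|T| ->
    #|T| <= q ^ h ->
    27 * (3 * (3 * (32 * k ^ 2)) * (q + 4)) * #|T| <= #|E| ->
  exists2 a, a <= 2 * h &
    forall l, a <= l < a + k -> contains_berge_cycle E l.
Proof.
move=> E3 h2 k2 T0 Tq dE; set D := 32 * k ^ 2 in dE.
have D0 : 0 < D by rewrite muln_gt0 expn_gt0 (ltnW k2).
have [f fE] := rainbow_colouring E3.
set E1 := [set e in E | _] in fE.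
have E1E : {subset E1 <= E} by move=> e; rewrite inE => /andP[].
set delta := 3 * (3 * D) * (q + 4) in dE.
have dE1 : delta * #|[set: T]| <= #|inside id E1 [set: T]|.
  have -> : inside id E1 [set: T] = E1.
    by apply/setP => e; rewrite in_set subsetT andbT.
  rewrite cardsT -(leq_pmul2l (isT : 0 < 27)) mulnA.
  exact: leq_trans dE fE.
have [||V _ critV] := @dense_critical_exists _ _ id delta E1 [set: T] => //.
  by rewrite -card_gt0 cardsT.
set H := inside id E1 V in critV.
have HE1 : {subset H <= E1} by move=> e; rewrite inE => /andP[].
have HE : {subset H <= E} by move=> e /HE1/E1E.
have HV e : e \in H -> e \subset V by rewrite inE => /andP[].
have H3 e : e \in H -> #|e| = 3 by move/HE/E3.
have [/set0Pn[r rV] _ _] := critV.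
have degV v : v \in V -> delta <= #|[set e in H | v \in e]|.
  apply: (critical_degree critV) => e /E1E/E3 e3.
  by rewrite -card_gt0 e3.
have VT : #|V| <= q ^ h by apply: leq_trans Tq; exact: max_card.
have D3 : 0 < 3 * D by rewrite muln_gt0.
have [i ih [S0 dS]] := heavy_layer H3 HV rV degV D3 (leqnn delta) (ltnW h2) VT.
pose vt c (e : {set T}) := odflt r [pick v in e | f v == c].
have vtP c e : e \in H -> vt c e \in e /\ f (vt c e) = c.
  move=> /HE1; rewrite inE => /andP[_ /forallP/(_ c)/exists_inP[v ve fv]].
  rewrite /vt; case: pickP => [u /andP[ue /eqP]//|/(_ v)].
  by rewrite ve fv.
pose M c := [set e in layer H r i | vt c e \in ball H r i.+1].
have ML c : M c \subset layer H r i by apply/subsetP => e; rewrite inE => /andP[].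
have LH : layer H r i \subset H by apply/subsetP => e; rewrite inE => /andP[].
have [c dM] : exists c, D * (#|sphere H r i| + #|sphere H r i.+1|) <= #|M c|.
  apply: contrapT => small.
  have : #|layer H r i| <= \sum_(c : 'I_3) #|M c|.
    apply: (@leq_trans #|\bigcup_(c : 'I_3) M c|).
      apply: subset_leq_card; apply/subsetP => e eL.
      have eH := subsetP LH e eL.
      have := eL; rewrite inE => /and3P[_ _ /pred0Pn[v /= /andP[ve vb]]].
      apply/bigcupP; exists (f v) => //; rewrite inE eL /=.
      suff -> : vt (f v) e = v by [].
      have inj : {in e &, injective f}.
        apply/imset_injP; rewrite H3 //; suff -> : f @: e = [set: 'I_3].
          by rewrite cardsT card_ord.
        apply/setP => a; rewrite inE; apply/imsetP.
        by have [ae fa] := vtP a e eH; exists (vt a e).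
      by have [ue fu] := vtP (f v) e eH; apply: inj.
    by elim/big_rec2: _ => [|a A N _ IH];
       rewrite ?cards0 // (leq_trans (leq_card_setU _ _)) // leq_add2l.
  have lt c : #|M c| < D * (#|sphere H r i| + #|sphere H r i.+1|).
    by rewrite ltnNge; apply/negP => dM; apply: small; exists c.
  rewrite leqNgt => /negP; apply; apply: leq_trans dS; rewrite !big_ord_recl big_ord0.
  have := leq_add (leq_add (lt ord0) (lt (lift ord0 ord0)))
    (lt (lift ord0 (lift ord0 ord0))).
  by rewrite -mulnA; move: (D * _) => X; clear; lia.
have [c2 [c3 [n2 n3 n23]]] := color_triple c.
have tr : tripartite (vt c) (vt c2) (vt c3) (M c).
  have MH e : e \in M c -> e \in H by move/(subsetP (ML c))/(subsetP LH).
  move=> e g /MH eH /MH gH.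
  have ne a b x y : x \in H -> y \in H -> a != b -> vt a x != vt b y.
    move=> xH yH; apply: contraNneq => /(congr1 f).
    by have [_ ->] := vtP a x xH; have [_ ->] := vtP b y yH; move->.
  split; rewrite ?ne //; apply/esym/eqP.
  rewrite eqEcard !subUset !sub1set !(fun a => (vtP a e eH).1) H3 //=.
  rewrite -setUA !cardsU1 !inE cards1 negb_or !ne //.
pose U := sphere H r i :|: sphere H r i.+1.
have [||||short|con] := @cycles_or_connections T (below H r i) (2 * i) k k2
    (vt c) (vt c2) (vt c3) (M c) U tr.
- move=> X XM X1; apply: (sphere_splits H3) X1.
  apply: subset_trans XM _; apply/subsetP => _ /imsetP[e + ->].
  rewrite inE => /andP[eL vb]; rewrite inE vb andbT.
  move: (eL); rewrite inE => /and3P[eH ei _].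
  by rewrite (disjointFr ei) // (vtP c e eH).1.
- by case/set0Pn: S0 => v vS; apply/set0Pn; exists v; rewrite inE vS.
- move=> e /(subsetP (ML c)); rewrite inE => /and3P[eH ei ei1].
  have /subsetP eb := ball_closed eH ei1; apply/subsetP => v ve.
  rewrite !in_setU !in_setD (eb v ve) (disjointFr ei ve) /= andbT.
  by rewrite orbN.
- by apply: leq_trans dM; rewrite leq_mul2l cardsU leq_subr orbT.
- exists 3; first by clear -h2; lia.
  move=> l /andP[l3 lk]; apply: (@contains_berge_cycleS _ (M c)).
    by apply/subsetP => e /(subsetP (ML c))/(subsetP LH)/HE.
  by apply: short; rewrite l3 /=; clear -lk; lia.
have [a ai ca] := cycles_through_tree (ML c) con.
exists a; first by apply: leq_trans ai _; clear -ih; lia.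
move=> l /ca; apply: contains_berge_cycleS; exact/subsetP.
Qed.

(** * From r-uniform to 3-uniform *)

Section Shadow.
Variable T : finType.
Implicit Types (E : {set {set T}}) (e s : {set T}).

(** Induction on the number of edges: a set [s] in few edges takes over all the
    edges containing it and one of them becomes its image under [phi]. No remaining
    edge contains [s], so [s] is not chosen again. *)
Lemma rich_or_shadow r k E : uniform r.+1 E ->
  (exists E0, [/\ E0 \subset E, E0 != set0 & forall e s, e \in E0 ->
     s \subset e -> #|s| = r -> k < #|[set f in E0 | s \subset f]|]) \/
  (exists E' (phi : {set T} -> {set T}), [/\ uniform r E', #|E| <= k * #|E'|,
     {in E' &, injective phi}
     & forall s, s \in E' -> phi s \in E /\ s \subset phi s]).
Proof.
have [n] := ubnP #|E|; elim: n E => // n IH E; rewrite ltnS => En uE.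
case: (eqVneq E set0) => [->|E0].
  right; exists set0, id; split=> [e||e f|s]; rewrite ?cards0 //; by rewrite inE.
have [rich|] := pselect (forall e s, e \in E -> s \subset e -> #|s| = r ->
    k < #|[set f in E | s \subset f]|); first by left; exists E; split.
move=> /existsNP[e /existsNP[s]] /not_implyP[eE] /not_implyP[se] /not_implyP[sr].
move/negP; rewrite -leqNgt => sk.
pose E1 := [set f in E | ~~ (s \subset f)].
have E1E f : f \in E1 -> f \in E by rewrite inE => /andP[].
have cE : #|E| <= #|[set f in E | s \subset f]| + #|E1|.
  rewrite -cardsUI; apply: leq_trans (leq_addr _ _); apply: subset_leq_card.
  by apply/subsetP => f fE; rewrite !inE fE orbN.
have lt1 : #|E1| < #|E|.
  apply: proper_card; apply/properP; split; first by apply/subsetP.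
  by exists e => //; rewrite inE eE se.
have [|||] := IH E1.
- exact: leq_trans En.
- by move=> f /E1E; exact: uE.
- case=> E2 [E21 E20 h]; left; exists E2; split=> //.
  by apply: subset_trans E21 _; apply/subsetP.
case=> E' [phi [uE' cE' phi_inj phiP]]; right.
have sE' : s \notin E'.
  by apply/negP => /phiP[]; rewrite inE => /andP[_ /negP].
exists (s |: E'), (fun t => if t == s then e else phi t); split.
- by move=> t /setU1P[->|/uE'].
- by rewrite cardsU1 sE' mulnDr muln1; apply: leq_trans cE _; rewrite leq_add.
- have ne t : t \in E' -> phi t <> e.
    by move=> /phiP[+ _] te; rewrite te inE se andbF.
  have nes t : t \in E' -> (t == s) = false.
    by move=> tE; apply: contraNF sE' => /eqP<-.
  move=> t u /setU1P[->|tE] /setU1P[->|uE1] //=; rewrite ?eqxx ?nes //.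
  + by move/esym/ne.
  + by move/ne.
  + exact: phi_inj.
- move=> t; case: (eqVneq t s) => [-> _|ts]; first by [].
  by rewrite !inE (negPf ts) /= => /phiP[/E1E].
Qed.

Lemma berge_cycle_lift E E' (phi : {set T} -> {set T}) l :
    {in E' &, injective phi} ->
    (forall s, s \in E' -> phi s \in E /\ s \subset phi s) ->
  contains_berge_cycle E' l -> contains_berge_cycle E l.
Proof.
move=> phi_inj phiP [C CE' [l3 [e [v [e_inj v_inj CE inc]]]]].
have eE' i : e i \in E' by apply: (subsetP CE'); rewrite CE imset_f.
exists [set phi (e i) | i : 'I_l].
  by apply/subsetP => _ /imsetP[i _ ->]; case: (phiP _ (eE' i)).
split=> //; exists (phi \o e), v; split=> //.
- by move=> i j /= /phi_inj h; apply: e_inj; apply: h.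
- move=> i; have [_ /subsetP sub] := phiP _ (eE' i).
  by have [h1 h2] := inc i; split; apply: sub.
Qed.

(** In the link graph of an (r-1)-subset S of an edge all degrees are above k, since
    the neighbours of u correspond to the edges containing the r-set S + u. *)
Lemma rich_cycles r k E : 2 < r -> 0 < k -> uniform r.+1 E -> E != set0 ->
    (forall e s, e \in E -> s \subset e -> #|s| = r ->
       k < #|[set f in E | s \subset f]|) ->
  forall l, 3 <= l <= k.+2 -> contains_berge_cycle E l.
Proof.
move=> r3 k0 uE /set0Pn[e eE] rich.
have /card_gt1P[x [y [xe ye xy]]] : 1 < #|e|.
  by rewrite uE // ltnS; apply: leq_trans r3.
pose S := e :\ x :\ y.
have cS : r.-1 = #|S|.
  have := uE e eE; rewrite (cardsD1 x) xe (cardsD1 y (e :\ x)) !inE ye eq_sym xy.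
  by rewrite /S; clear; lia.
have Se : S \subset e.
  by apply: subset_trans (subsetDl _ _) _; exact: subsetDl.
pose G := [set f in E | S \subset f].
pose Q := [set u | [exists f in G, u \in f :\: S]].
have GE : G \subset E by apply/subsetP => f; rewrite inE => /andP[].
have S2 : 1 < #|S| by rewrite -cS; clear -r3; lia.
have [|||fan fan1] := @fan_cycles _ E G S Q k.+1 GE.
- move=> f; rewrite inE => /andP[fE Sf]; split=> //.
  by rewrite cardsD (setIidPr Sf) uE // -cS; clear -r3; lia.
- apply/set0Pn; exists x; rewrite inE; apply/exists_inP; exists e.
    by rewrite inE eE Se.
  by rewrite !inE eqxx andbF xe.
- move=> u; rewrite inE => /exists_inP[f]; rewrite inE => /andP[fE Sf].
  rewrite inE => /andP[uS uf].
  have := rich f (u |: S) fE; rewrite cardsU1 uS -cS subUset sub1set uf Sf.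
  move=> /(_ isT) h; apply: leq_trans (h _) _; first by clear -r3; lia.
  apply: subset_leq_card; apply/subsetP => g /setIdP[gE].
  rewrite subUset sub1set => /andP[ug Sg].
  have gG : g \in G by rewrite inE gE Sg.
  apply/setIdP; split; last by rewrite inE uS ug.
  apply/setIdP; split=> //; apply/subsetP => w wg; rewrite inE.
  by apply/exists_inP; exists g.
move=> l /andP[l3]; rewrite leq_eqVlt => /orP[/eqP->|lk].
  exact: fan1.
apply: fan; last by rewrite l3 -ltnS.
by rewrite -card_gt0 (ltnW S2).
Qed.

(** Each step down loses the factor [k] and no constant. *)
Lemma reduce_to_three r k E : 2 < r -> 0 < k -> uniform r E ->
  (forall l, 3 <= l <= k.+2 -> contains_berge_cycle E l) \/
  exists E3, [/\ uniform 3 E3, #|E| <= k ^ (r - 3) * #|E3|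
    & forall l, contains_berge_cycle E3 l -> contains_berge_cycle E l].
Proof.
move=> + k0; elim: r E => // r IH E; rewrite ltnS leq_eqVlt => /orP[/eqP r2|r3] uE.
  by right; exists E; rewrite -r2 in uE *; rewrite subnn mul1n.
have [[E0 [E0E E00 rich]]|[E' [phi [uE' cE' phi_inj phiP]]]] := rich_or_shadow k uE.
  left=> l lk; apply: (contains_berge_cycleS E0E).
  by apply: (rich_cycles r3 k0 _ E00 rich lk) => e /(subsetP E0E); exact: uE.
have lift := @berge_cycle_lift E E' phi _ phi_inj phiP.
have [cyc|[E3 [u3 c3 l3]]] := IH E' r3 uE'; first by left=> l /cyc/lift.
right; exists E3; split=> //; last by move=> l /l3/lift.
apply: leq_trans cE' _; rewrite subSn // expnS -mulnA leq_mul2l c3 orbT.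
by [].
Qed.

End Shadow.

Import Order.TTheory GRing.Theory Num.Theory.
Local Open Scope ring_scope.

Theorem theorem5p3 (R : realType) :
  exists2 c : R, 0 < c &
    forall (h k r : nat), (2 <= h)%N -> (2 <= k)%N -> (3 <= r)%N ->
    forall (T : finType) (E : {set {set T}}), (0 < #|T|)%N -> uniform r E ->
      c * k%:R ^+ (r - 1) * (#|T|%:R `^ (1 + h%:R^-1)) <= #|E|%:R ->
      exists2 a : nat, (a <= 2 * h)%N &
        forall l : nat, (a <= l < a + k)%N -> contains_berge_cycle E l.
Proof.
(* The factor 6 bounds q + 4 by 6x, where q exceeds the integral part of
   x = n^(1/h) >= 1 by one. *)
pose m := (27 * (3 * (3 * 32)))%N; pose c0 := (m * 6)%N.
exists c0%:R => [|h k r h2 k2 r3 T E T0 uE dE]; first by rewrite ltr0n.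
have k0 : (0 < k)%N by apply: ltnW.
have h0 : (0 < h)%N by apply: ltnW.
have [cyc|[E3 [u3 c3 l3]]] := reduce_to_three r3 k0 uE.
  exists 3%N; first by apply: leq_trans (_ : 2 * 2 <= _)%N => //; rewrite leq_mul2l.
  by move=> l /andP[l3 lk]; apply: cyc; rewrite l3 /=; clear -lk; lia.
pose x : R := #|T|%:R `^ h%:R^-1.
pose q := (Num.truncn x).+1.
have n1 : 1 <= #|T|%:R :> R by rewrite ler1n.
have x0 : 0 <= x by exact: powR_ge0.
have x1 : 1 <= x.
  have h1 : 0 <= h%:R^-1 :> R by rewrite invr_ge0.
  have := ge0_ler_powR h1 _ _ n1; rewrite powR1.
  by apply; rewrite nnegrE.
have xh : x ^+ h = #|T|%:R.
  rewrite -powR_mulrn // -powRrM mulVf ?powRr1 ?ler0n //.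
  by rewrite pnatr_eq0 -lt0n.
have /andP[qx xq] := truncn_itv x0; rewrite -/q in xq.
have q4 : (q + 4)%:R <= 6 * x.
  have -> : (q + 4)%:R = (Num.truncn x)%:R + 5 :> R by rewrite -natrD /q addSnnS.
  by lra.
have Tq : (#|T| <= q ^ h)%N.
  rewrite -(ler_nat R) natrX -xh; apply: lerXn2r; rewrite ?nnegrE //.
  exact: ltW.
have [|a ah ca] := three_uniform_cycles u3 h2 k2 T0 Tq; last first.
  by exists a => // l /ca/l3.
have kr : 0 < k%:R ^+ (r - 3) :> R by rewrite exprn_gt0 // ltr0n.
have dE3 : c0%:R * k%:R ^+ 2 * (#|T|%:R * x) <= #|E3|%:R :> R.
  rewrite -(ler_pM2l kr); apply: (@le_trans _ _ #|E|%:R); last first.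
    by rewrite -natrX -natrM ler_nat.
  apply: le_trans dE; rewrite le_eqVlt; apply/orP; left; apply/eqP.
  rewrite powRD; last by rewrite pnatr_eq0 -lt0n T0 implybT.
  rewrite powRr1 ?ler0n // -/x.
  have -> : (r - 1 = (r - 3) + 2)%N by clear -r3; lia.
  by rewrite exprD; ring.
rewrite -(ler_nat R); apply: le_trans dE3.
have -> : (27 * (3 * (3 * (32 * k ^ 2)) * (q + 4)) * #|T|
    = m * k ^ 2 * #|T| * (q + 4))%N by rewrite [RHS]mulnAC /m !mulnA.
clearbody m; rewrite /c0 !(natrX, natrM).
have -> : m%:R * 6%:R * k%:R ^+ 2 * (#|T|%:R * x)
    = m%:R * k%:R ^+ 2 * #|T|%:R * (6 * x) :> R by ring.
by rewrite ler_wpM2l // !mulr_ge0 // exprn_ge0.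
Qed.
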